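(* Let $n\ge 1$. For a subset $K\subseteq[n-1]$, the $h$-polynomial of the partitioned permutohedron $P_n(K)$ satisfies $$h_{P_n(K)}(t)=\sum_{j=0}^{\lfloor\frac{n-1}{2}\rfloor}\gamma_{n,j,K}\,t^j(1+t)^{n-1-2j},$$ where for each $j$, $$\gamma_{n,j,K}=|\{w\in\widetilde{W^K}\mid\operatorname{des}(w)=j\}|=|\{w\in\widehat{W^K}\mid\operatorname{des}(w)=j\}|.$$
   Context: Notation: $[m]=\{1,\dots,m\}$, and $\mathfrak{S}_n$ is the symmetric group on $[n]$, with $w\in\mathfrak{S}_n$ written in one-line notation $w(1)w(2)\cdots w(n)$. Partitioned permutohedra. Fix $p=(p_1,\dots,p_n)\in\mathbb{R}^n$ with pairwise distinct entries and let $E\subset\mathbb{R}^n$ be the affine hyperplane of vectors whose coordinate sum equals $\sum_i p_i$. The permutohedron $P_n$ is the convex hull of the points $(p_{w(1)},\dots,p_{w(n)})$, $w\in\mathfrak{S}_n$. For $k\in[n-1]$ let $H(k)^{\le}=\{(x_1,\dots,x_n)\in E\mid x_k\le x_{k+1}\}$. For $K\subseteq[n-1]$ the partitioned permutohedron is $P_n(K)=P_n\cap\bigcap_{k\in K}H(k)^{\le}$. It is known that $P_n(K)$ is a simple polytope of dimension $n-1$. Its $h$-polynomial is $h_{P_n(K)}(t)=\sum_{i=0}^{n-1}f_i(t-1)^i$, where $f_i$ is the number of $i$-dimensional faces of $P_n(K)$ (so $f_{n-1}=1$). Descents. A descent of $w\in\mathfrak{S}_n$ is an $i\in[n-1]$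 with $w(i)>w(i+1)$; $\operatorname{Des}(w)$ is the set of descents and $\operatorname{des}(w)=|\operatorname{Des}(w)|$. $w$ has a double descent if $\{i,i+1\}\subseteq\operatorname{Des}(w)$ for some $i\in[n-2]$, an initial descent if $1\in\operatorname{Des}(w)$, and a final descent if $n-1\in\operatorname{Des}(w)$. The sets $W^K$, $\widetilde{W^K}$, $\widehat{W^K}$. Let $W_K\le\mathfrak{S}_n$ be the subgroup generated by the transpositions $(k,k+1)$, $k\in K$. Permutations are composed from left to right, and $W^K$ is the set of minimal length representatives of the left cosets $wW_K$, the length of $w$ being its number of inversions. Explicitly, $w\in W^K$ if and only if for every $k\in K$ the letter $k$ appears to the left of $k+1$ in the one-line notation of $w$, i.e. $w^{-1}(k)<w^{-1}(k+1)$. $\widetilde{W^K}$ is the set of $w\in W^K$ with no double descent and no initial descent; $\widehat{W^K}$ is the set of $w\in W^K$ with no double descent and no final descent. *)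

(* Defs.v *)
From mathcomp Require Import all_boot all_order all_fingroup all_algebra.
From mathcomp Require Import finmap boolp classical_sets functions cardinality reals.

Set Implicit Arguments.
Unset Strict Implicit.
Unset Printing Implicit Defensive.

Import Order.TTheory GRing.Theory Num.Theory.
Local Open Scope ring_scope.

(* Everything is 0-based: [n] is 'I_n, and [n-1] is 'I_n.-1, an element
   k : 'I_n.-1 standing for the pair of consecutive positions (k, k+1). *)

Lemma posr_subproof (n : nat) (k : 'I_n.-1) : (k.+1 < n)%N.
Proof. by rewrite -ltn_predRL. Qed.

Definition posl (n : nat) (k : 'I_n.-1) : 'I_n := widen_ord (leq_pred n) k.
Definition posr (n : nat) (k : 'I_n.-1) : 'I_n := Ordinal (posr_subproof k).

Section Polytopes.
Local Open Scope classical_set_scope.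
Context {R : realType} {n : nat}.
Implicit Types (A P F : set 'rV[R]_n) (c x : 'rV[R]_n).

Definition conv_hull A : set 'rV[R]_n := [set x | exists m : nat,
  exists a : 'I_m -> R, exists v : 'I_m -> 'rV[R]_n,
  [/\ forall i, A (v i), forall i, 0 <= a i,
      \sum_i a i = 1 & x = \sum_i a i *: v i]].

Definition aff_hull A : set 'rV[R]_n := [set x | exists m : nat,
  exists a : 'I_m -> R, exists v : 'I_m -> 'rV[R]_n,
  [/\ forall i, A (v i), \sum_i a i = 1 & x = \sum_i a i *: v i]].

(* Only nonempty sets have a dimension here. *)
Definition has_dim A (d : nat) : Prop :=
  exists x0 : 'rV[R]_n, exists U : {vspace 'rV[R]_n},
    aff_hull A = [set x | x - x0 \in U] /\ \dim U = d.

Definition dotv c x : R := \sum_j c 0 j * x 0 j.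

(* c = 0 gives F = P (b = 0) and F = set0 (b = 1). *)
Definition is_face P F : Prop :=
  exists c : 'rV[R]_n, exists b : R,
    (forall x, P x -> dotv c x <= b) /\ F = [set x | P x /\ dotv c x = b].

(* fset_set is the set itself when finite, as it is for a polytope P, and
   the empty set otherwise. *)
Definition nfaces P (i : nat) : nat :=
  #|` fset_set [set F | is_face P F /\ has_dim F i] |%fset.

(* d is the dimension of P *)
Definition hpoly (d : nat) P : {poly int} :=
  \sum_(i < d.+1) (nfaces P i)%:R *: ('X - 1) ^+ i.

Definition permutohedron (p : 'rV[R]_n) : set 'rV[R]_n :=
  conv_hull [set \row_j p 0 (w j) | w in [set: 'S_n]].

Definition hyperplaneE (p : 'rV[R]_n) : set 'rV[R]_n :=
  [set x | \sum_i x 0 i = \sum_i p 0 i].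

Definition halfspace (p : 'rV[R]_n) (k : 'I_n.-1) : set 'rV[R]_n :=
  [set x | hyperplaneE p x /\ x 0 (posl k) <= x 0 (posr k)].

Definition part_permutohedron (p : 'rV[R]_n) (K : {set 'I_n.-1}) :
    set 'rV[R]_n :=
  permutohedron p `&` \bigcap_(k in [set` K]) halfspace p k.

End Polytopes.

Section Permutations.
Local Open Scope group_scope.
Context {n : nat}.
Implicit Types (w : 'S_n) (K : {set 'I_n.-1}).

Definition Des w : {set 'I_n.-1} := [set i | w (posr i) < w (posl i)]%N.

Definition des w : nat := #|Des w|.

Definition double_descent w : bool :=
  [exists i in Des w, exists j in Des w, j == i.+1 :> nat].

Definition initial_descent w : bool := [exists i in Des w, i == 0%N :> nat].

Definition final_descent w : bool := [exists i in Des w, i.+1 == n.-1 :> nat].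

Definition perm_length w : nat :=
  #|[set ij : 'I_n * 'I_n | (ij.1 < ij.2) && (w ij.2 < w ij.1)]%N|.

Definition WK_subgroup K : {group 'S_n} :=
  <<[set tperm (posl k) (posr k) | k in K]>>%G.

(* The product of 'S_n composes from left to right: (w * u) i = u (w i). *)
Definition WK K : {set 'S_n} :=
  [set w | [forall v in w *: WK_subgroup K, perm_length w <= perm_length v]%N].

Definition WK_tilde K : {set 'S_n} :=
  [set w in WK K | ~~ double_descent w & ~~ initial_descent w].

Definition WK_hat K : {set 'S_n} :=
  [set w in WK K | ~~ double_descent w & ~~ final_descent w].

End Permutations.

(* Main.v *)
(* The tight constraints of a point of P_n(K) are encoded by a chain D of proper nonempty subsets of
   [n] that are low (they contain k whenever they contain k+1, for k in K), on which the coordinate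
   sum is minimal, and a set J of equalities x_k = x_(k+1), k in K, such that no member of D separates
   k from k+1 for k in J.  By Rado's description of the permutohedron by inequalities, the nonempty
   faces correspond to these pairs (D, J).  The family of pairs is closed under passing to smaller D
   and J, so each constraint lowers the dimension by one and the h-polynomial is the sum of
   (t-1)^(n-1-|D|-|J|) over all pairs.

   Summing over J, and over the smallest member of D, gives a recursion along the lattice of low sets,
   h = (t-1) (t - C)^-1 in its incidence algebra, where C(S, T) = (t-1)^(b-e) t^e if T \ S has b elements
   and contains e pairs {k, k+1}, k in K.  Let E(z)(S, T) be z^b if e = 0, and 0 otherwise.  Then
   C E(-t) = E(-1), hence h = E(-t) F where F is the inverse of (t E(-t) - E(-1)) / (t-1).  Expanding F
   over words (the elements of W^K are the maximal chains of low sets), each word is weighted by the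
   product of 1+t and t over its maximal strictly decreasing runs of lengths 1 and 2, longer runs being
   excluded; the factor E(-t) forces the first run to have length 1 and drops its weight.  This is the
   sum over the permutations without double or initial descents.  Conjugation by the longest element
   exchanges initial and final descents and reverses K, which does not change the number of pairs
   (D, J); comparing coefficients gives the second count. *)
From HB Require Import structures.
Require Import Defs.
From mathcomp Require Import all_boot all_order all_fingroup all_algebra.
From mathcomp Require Import finmap boolp classical_sets functions cardinality reals.
(* Imported again because classical_sets hides their lemmas on {set T}. *)
From mathcomp Require Import fintype finset.
From mathcomp Require Import ring lra zify.
Set Implicit Arguments.
Unset Strict Implicit.
Unset Printing Implicit Defensive.
Import Order.TTheory GRing.Theory Num.Theory.
Local Open Scope ring_scope.

(** * Faces of polytopes defined by inequalities *)

Section DotProduct.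
Context {R : realType} {n : nat}.
Implicit Types c x y : 'rV[R]_n.

Lemma dotvDr c x y : dotv c (x + y) = dotv c x + dotv c y.
Proof. by rewrite -big_split; apply: eq_bigr => j _; rewrite mxE mulrDr. Qed.

Lemma dotvZr c (k : R) x : dotv c (k *: x) = k * dotv c x.
Proof. by rewrite /dotv mulr_sumr; apply: eq_bigr => j _; rewrite mxE; ring. Qed.

Lemma dotvBr c x y : dotv c (x - y) = dotv c x - dotv c y.
Proof. by rewrite dotvDr -scaleN1r dotvZr mulN1r. Qed.

Lemma dotv0r c : dotv c 0 = 0.
Proof. by rewrite -(scale0r 0) dotvZr mul0r. Qed.

Lemma dotv_sumr c (I : Type) (r : seq I) (P : pred I) (F : I -> 'rV[R]_n) :
  dotv c (\sum_(i <- r | P i) F i) = \sum_(i <- r | P i) dotv c (F i).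
Proof.
exact: (big_morph (dotv c) (dotvDr c) (dotv0r c)).
Qed.

Lemma dotvC c x : dotv c x = dotv x c.
Proof. by apply: eq_bigr => j _; rewrite mulrC. Qed.

Lemma dotv_suml x (I : Type) (r : seq I) (P : pred I) (F : I -> 'rV[R]_n) :
  dotv (\sum_(i <- r | P i) F i) x = \sum_(i <- r | P i) dotv (F i) x.
Proof. by rewrite dotvC dotv_sumr; apply: eq_bigr => i _; rewrite dotvC. Qed.

Lemma dotvNl c x : dotv (- c) x = - dotv c x.
Proof. by rewrite dotvC -scaleN1r dotvZr mulN1r dotvC. Qed.

Definition dotv_lfun c : 'Hom('rV[R]_n, R^o) := linfun (dotv c : _ -> R^o).

Lemma dotv_lfunE c x : dotv_lfun c x = dotv c x.
Proof.
have lin : linear (dotv c : _ -> R^o) by move=> k u v; rewrite dotvDr dotvZr.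
pose L := GRing.isLinear.Build _ _ _ _ _ lin.
pose f : {linear _ -> _} := HB.pack (dotv c : _ -> R^o) L.
by rewrite /dotv_lfun -[dotv c]/(f : _ -> _) lfunE.
Qed.

Lemma dim_cap_hyperplane (U : {vspace 'rV[R]_n}) c :
  (\dim U <= (\dim (U :&: lker (dotv_lfun c))).+1)%N.
Proof.
have le1 : (\dim (dotv_lfun c @: U) <= 1)%N by rewrite (leq_trans (dimvS (subvf _))) // dimvf.
apply: leq_trans (eq_leq (esym (limg_ker_dim (dotv_lfun c) U))) _.
by apply: leq_trans (leq_add (leqnn _) le1) _; rewrite addn1.
Qed.

End DotProduct.

(** The inverse of one plus the sum of the inverses serves as the bound; it is positive even when
    [P] is empty, unlike a minimum. *)
Lemma pos_lower_bound (R : realType) (I : finType) (P : pred I) (f : I -> R) :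
  (forall i, P i -> 0 < f i) -> exists2 eps, 0 < eps & forall i, P i -> eps <= f i.
Proof.
move=> f0; pose s := \sum_(i | P i) (f i)^-1.
have s0 : 0 <= s by apply: sumr_ge0 => i Pi; rewrite invr_ge0 ltW // f0.
exists (s + 1)^-1 => [|i Pi]; first by rewrite invr_gt0; lra.
rewrite -[leRHS]invrK lef_pV2 ?posrE ?invr_gt0 ?f0 //; last lra.
rewrite /s (bigD1 i) //=.
have : 0 <= \sum_(j | P j && (j != i)) (f j)^-1.
  by apply: sumr_ge0 => j /andP[Pj _]; rewrite invr_ge0 ltW // f0.
lra.
Qed.

Lemma ltr_sum_one (R : numDomainType) (I : finType) (P : pred I) (f g : I -> R) i :
  P i -> f i < g i -> (forall j, P j -> f j <= g j) ->
  \sum_(j | P j) f j < \sum_(j | P j) g j.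
Proof.
move=> Pi lt_i le; rewrite (bigD1 i) // [ltRHS](bigD1 i) //= ltr_leD //.
by apply: ler_sum => j /andP[Pj _]; exact: le.
Qed.

Section HPolytope.
Local Open Scope classical_set_scope.
Context {R : realType} {n : nat} {I : finType}.
Context (e : 'rV[R]_n) (e0 : R) (a : I -> 'rV[R]_n) (b : I -> R) (C : {set I}).
Implicit Types (x y z v c : 'rV[R]_n) (F : set 'rV[R]_n) (t : {set I}).

Definition hpolytope : set 'rV[R]_n :=
  [set x | dotv e x = e0 /\ forall i, i \in C -> b i <= dotv (a i) x].

Local Notation P := hpolytope.

Definition tight x : {set I} := [set i in C | dotv (a i) x == b i].

(** When [t] is the tight set of a point, this is the direction of the affine hull of [face_of t];
    see [aff_hull_face]. *)
Definition tight_dir t : {vspace 'rV[R]_n} :=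
  (lker (dotv_lfun e) :&: \bigcap_(i in t) lker (dotv_lfun (a i)))%VS.

Definition face_of t : set 'rV[R]_n := [set z | P z /\ t \subset tight z].

Lemma tight_dirP t v :
  reflect (dotv e v = 0 /\ forall i, i \in t -> dotv (a i) v = 0) (v \in tight_dir t).
Proof.
rewrite memv_cap memv_ker dotv_lfunE memvE.
apply: (iffP andP) => [[/eqP ev /subv_bigcapP tv]|[ev tv]]; split => //.
- by move=> i it; have := tv i it; rewrite -memvE memv_ker dotv_lfunE => /eqP.
- exact/eqP.
- by apply/subv_bigcapP => i it; rewrite -memvE memv_ker dotv_lfunE tv.
Qed.

Lemma tightP x i : reflect (i \in C /\ dotv (a i) x = b i) (i \in tight x).
Proof. by rewrite inE; apply: (iffP andP) => -[iC /eqP]. Qed.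

Lemma hpolytope_move x v : P x -> dotv e v = 0 ->
    (forall i, i \in tight x -> 0 <= dotv (a i) v) ->
  exists2 eps, 0 < eps & P (x + eps *: v).
Proof.
move=> [ex ax] ev tv.
(* The slack of a constraint over a bound for the rate at which [v] uses it up; the 1 keeps the
   denominator positive. *)
pose f i := (dotv (a i) x - b i) / (1 + `|dotv (a i) v|).
pose Q i := (i \in C) && (i \notin tight x).
have den i : 0 < 1 + `|dotv (a i) v| by have := normr_ge0 (dotv (a i) v); lra.
have f0 i : Q i -> 0 < f i.
  move=> /andP[iC]; rewrite inE iC /= => ne.
  by rewrite divr_gt0 // subr_gt0 lt_neqAle eq_sym ne ax.
have [eps eps0 le_eps] := pos_lower_bound f0.
exists eps => //; split => [|i iC]; first by rewrite dotvDr dotvZr ev mulr0 addr0.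
rewrite dotvDr dotvZr; have [it|nit] := boolP (i \in tight x).
  by have := tv i it; have := ax i iC; nra.
have := le_eps i; rewrite /Q iC nit /f ler_pdivlMr // => /(_ isT).
have : - `|dotv (a i) v| <= dotv (a i) v by rewrite lerNl -normrN ler_norm.
by nra.
Qed.

(** The supporting form is minus the sum of the tight constraints: a sum of inequalities is an
    equality only if each of them is. *)
Lemma face_of_is_face x : P x -> is_face P (face_of (tight x)).
Proof.
move=> Px; exists (- \sum_(i in tight x) a i), (- \sum_(i in tight x) b i).
have le z : P z -> \sum_(i in tight x) b i <= dotv (\sum_(i in tight x) a i) z.
  move=> [_ az]; rewrite dotv_suml ler_sum // => i /tightP[iC _]; exact: az.
split => [z Pz|]; first by rewrite dotvNl lerN2 le.
apply/seteqP; split => z /=.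
- case=> Pz sub; split => //; rewrite dotvNl; congr (- _).
  rewrite dotv_suml; apply: eq_bigr => i it.
  by have /tightP[] := subsetP sub i it.
- case=> Pz; rewrite dotvNl => /oppr_inj eqb; split => //.
  apply/subsetP => i it; have /tightP[iC _] := it; apply/tightP; split => //.
  apply/eqP; rewrite eq_le Pz.2 // andbT leNgt; apply/negP => lt_i.
  have : \sum_(j in tight x) b j < dotv (\sum_(j in tight x) a j) z.
    rewrite dotv_suml; apply: (ltr_sum_one it lt_i) => j /tightP[jC _].
    exact: Pz.2.
  by rewrite eqb ltxx.
Qed.

(* A point of F with the fewest tight constraints is a relative interior point. *)
Lemma is_face_tight F : is_face P F -> F !=set0 ->
  exists2 x, P x & F = face_of (tight x).
Proof.
move=> [c [d [cd ->]]] [x0 Fx0].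
pose Q m := `[< exists x, [/\ P x, dotv c x = d & #|tight x| = m] >].
have exQ : exists m, Q m by exists #|tight x0|; apply/asboolP; exists x0; case: Fx0.
have [m /asboolP[x [Px cx <-]] minx] := ex_minnP exQ.
(* The midpoint of [x] and [z] is tight only where both are, so the minimality of [x] makes every
   constraint tight at [x] tight at [z]. *)
have mid z : P z -> dotv c z = d -> tight x \subset tight z.
  move=> Pz cz; pose y := 2^-1 *: (x + z).
  have dy u : dotv u y = 2^-1 * (dotv u x + dotv u z) by rewrite dotvZr dotvDr.
  have Py : P y.
    split => [|i iC]; rewrite dy; first by rewrite Px.1 Pz.1; lra.
    by have := Px.2 _ iC; have := Pz.2 _ iC; lra.
  have sub : tight y \subset tight x :&: tight z.
    apply/subsetP => i /tightP[iC]; rewrite dy => eqi.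
    have := Px.2 _ iC; have := Pz.2 _ iC => lez lex.
    by rewrite inE; apply/andP; split; apply/tightP; split => //; lra.
  have : (#|tight x| <= #|tight y|)%N.
    by apply/minx/asboolP; exists y; split => //; rewrite dy cx cz; lra.
  move=> le; have /eqP : tight y == tight x.
    by rewrite eqEcard le andbT (subset_trans sub) ?subsetIl.
  by move=> <-; rewrite (subset_trans sub) ?subsetIr.
exists x => //; apply/seteqP; split => z /=; first by case=> Pz cz; split => //; exact: mid.
case=> Pz sub; split => //; apply/eqP; rewrite eq_le cd //= leNgt.
apply/negP => lt_z.
(* A small step from [x] away from [z] stays in [P], and it would push the value of [c] above its
   maximum [d]. *)
have [||eps eps0 Py] := @hpolytope_move x (x - z) Px.
- by rewrite dotvBr Px.1 Pz.1 subrr.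
- move=> i it; have /tightP[_ zi] := subsetP sub i it; have /tightP[_ xi] := it.
  by rewrite dotvBr zi xi subrr.
have := cd _ Py; rewrite dotvDr dotvZr dotvBr cx.
by nra.
Qed.

Lemma aff_hull_face x : P x ->
  aff_hull (face_of (tight x)) = [set y | y - x \in tight_dir (tight x)].
Proof.
move=> Px; apply/seteqP; split => y /=.
- case=> m [k [v [Fv k1 ->]]].
  have eqx : x = \sum_i k i *: x by rewrite -scaler_suml k1 scale1r.
  rewrite [X in _ - X]eqx -sumrB; apply: memv_suml => i _; rewrite -scalerBr memvZ //.
  have [[ev _] tv] := Fv i.
  apply/tight_dirP; split => [|j jt]; first by rewrite dotvBr ev Px.1 subrr.
  have /tightP[_ vj] := subsetP tv j jt; have /tightP[_ xj] := jt.
  by rewrite dotvBr vj xj subrr.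
- move=> /tight_dirP[ed td].
  have [||eps eps0 Py] := @hpolytope_move x (y - x) Px => //.
    by move=> i it; rewrite td.
  (* [y] lies on the line through [x] and the face point [x + eps *: (y - x)], with affine
     coordinates 1 - 1/eps and 1/eps. *)
  exists 2%N, (fun i : 'I_2 => if i == 0 then 1 - eps^-1 else eps^-1),
    (fun i : 'I_2 => if i == 0 then x else x + eps *: (y - x)).
  split.
  + move=> i; case: ifP => _; split => //; apply/subsetP => j jt.
    have /tightP[jC xj] := jt; apply/tightP; split => //.
    by rewrite dotvDr dotvZr td // mulr0 addr0.
  + by rewrite !big_ord_recl big_ord0 /=; lra.
  + rewrite !big_ord_recl big_ord0 /= addr0 scalerDr scalerA mulVf ?gt_eqF // scale1r.
    by rewrite addrA -scalerDl subrK scale1r addrC subrK.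
Qed.

Lemma has_dim_face x d : P x ->
  has_dim (face_of (tight x)) d <-> \dim (tight_dir (tight x)) = d.
Proof.
move=> Px; rewrite /has_dim aff_hull_face //; split; last by exists x, (tight_dir (tight x)).
case=> x0 [U [eqU <-]]; congr (\dim _).
have mem y : (y - x \in tight_dir (tight x)) = (y - x0 \in U).
  by have /seteqP[sub1 sub2] := eqU; apply/idP/idP; [exact: (sub1 y)|exact: (sub2 y)].
have xU : x - x0 \in U by rewrite -mem subrr mem0v.
apply/vspaceP => v.
by rewrite -{1}(addrK x v) mem -addrA rpredDr.
Qed.

Definition realizable t := exists2 x, P x & tight x = t.

(** This closure property expresses simplicity: the faces containing a given nonempty face form a
    Boolean lattice, one for each subset of its tight constraints. *)
Context (realizable_sub : forall t t', t' \subset t -> realizable t -> realizable t').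

(* Removing one tight constraint enlarges the direction space by exactly one dimension,
   as the difference of two points realizing the two tight sets shows. *)
Lemma dim_tight_dir t : realizable t -> \dim (tight_dir t) = (\dim (tight_dir finset.set0) - #|t|)%N
  /\ (#|t| <= \dim (tight_dir finset.set0))%N.
Proof.
have [m] := ubnP #|t|; elim: m t => // m IH t lt_m rt.
have [->|[i it]] := set_0Vmem t; first by rewrite cards0 subn0.
have card_t := cardsD1 i t; rewrite it /= in card_t.
have subt : t :\ i \subset t by rewrite subsetDl.
have rt' := realizable_sub subt rt.
have [|dim_t' le_t'] := IH (t :\ i) _ rt'; first by move: lt_m; rewrite card_t add1n.
have eq_dir : tight_dir t = (tight_dir (t :\ i) :&: lker (dotv_lfun (a i)))%VS.
  apply/vspaceP => v; rewrite memv_cap memv_ker dotv_lfunE.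
  apply/tight_dirP/andP => [[ev tv]|[/tight_dirP[ev tv] /eqP iv]]; split => //.
  - by apply/tight_dirP; split => // j; rewrite !inE => /andP[_ jt]; exact: tv.
  - by rewrite tv.
  - move=> j jt; have [->//|ji] := eqVneq j i.
    by apply: tv; rewrite !inE ji.
have le1 := dim_cap_hyperplane (tight_dir (t :\ i)) (a i); rewrite -eq_dir in le1.
have lt1 : (\dim (tight_dir t) < \dim (tight_dir (t :\ i)))%N.
  have sub : (tight_dir t <= tight_dir (t :\ i))%VS by rewrite eq_dir capvSl.
  rewrite ltn_neqAle dimvS // andbT (dimv_leqif_eq sub).2; apply/negP => /eqP eqd.
  have [x Px tx] := rt; have [y Py ty] := rt'.
  have : y - x \in tight_dir (t :\ i).
    apply/tight_dirP; split => [|j jt]; first by rewrite dotvBr Py.1 Px.1 subrr.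
    have jt' := subsetP subt j jt.
    have /tightP[_ yj] : j \in tight y by rewrite ty.
    have /tightP[_ xj] : j \in tight x by rewrite tx.
    by rewrite dotvBr yj xj subrr.
  rewrite -eqd => /tight_dirP[_ /(_ i it)]; rewrite dotvBr => /eqP; rewrite subr_eq0 => /eqP yx.
  have /tightP[iC xi] : i \in tight x by rewrite tx.
  have : i \in tight y by apply/tightP; split; rewrite ?yx.
  by rewrite ty !inE eqxx.
lia.
Qed.

(** [face_of] is a bijection from the realizable sets to the nonempty faces. It is injective because
    points realizing two sets with the same face lie in each other's face, so each tight set
    contains the other. *)
Lemma nfaces_hpolytope d (T : {set {set I}}) : (forall t, t \in T <-> realizable t) ->
  nfaces P d = #|[set t in T | \dim (tight_dir t) == d]|.
Proof.
move=> TP; pose A := [set t in T | \dim (tight_dir t) == d].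
have -> : nfaces P d = #|` fset_set [set face_of t | t in [set` A]]|%fset.
  congr #|` fset_set _|%fset; apply/seteqP; split => F /=.
  - case=> faceF dimF; have F0 : F !=set0.
      case: dimF => x0 [U [eqU _]]; apply/set0P/negP => /eqP F0.
      have : aff_hull F x0 by rewrite eqU /= subrr mem0v.
      (* An affine combination of no points has coefficient sum 0 instead of 1, so the empty face
         has no dimension. *)
      rewrite F0 => -[[|m] [k [v [v0 k1 _]]]]; last exact: (v0 ord0).
      by move: k1 => /eqP; rewrite big_ord0 eq_sym oner_eq0.
    have [x Px eqF] := is_face_tight faceF F0; exists (tight x); last by rewrite eqF.
    rewrite /= inE; apply/andP; split; first by apply/TP; exists x.
    by apply/eqP/(has_dim_face _ Px); rewrite -eqF.
  - case=> t; rewrite /= inE => /andP[/TP[x Px <-] /eqP dimx] <-; split.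
    + exact: face_of_is_face.
    + exact/has_dim_face.
rewrite fset_set_image; last exact: finite_finset.
rewrite card_in_imfset /=; last first.
  move=> t t'; rewrite !in_fset_set; try exact: finite_finset.
  rewrite !mem_setE /= !inE => /andP[/TP[x Px <-] _] /andP[/TP[y Py <-] _] eqF.
  apply/eqP; rewrite eqEsubset; apply/andP; split.
  - have [] : face_of (tight x) y by rewrite eqF.
    by [].
  - have [] : face_of (tight y) x by rewrite -eqF.
    by [].
rewrite cardE; apply/eqP; rewrite eqn_leq; apply/andP; split.
all: apply: uniq_leq_size; rewrite ?enum_uniq ?fset_uniq // => t.
all: by rewrite mem_enum in_fset_set ?mem_setE //; exact: finite_finset.
Qed.

End HPolytope.

(** * Rado's theorem *)

(** An index is sent to its rank, the number of keys smaller than its own. *)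
Lemma rank_perm (n : nat) (disp : Order.disp_t) (T : orderType disp) (kappa : 'I_n -> T) :
  injective kappa ->
  exists s : 'S_n, forall i j, (s i < s j)%N = (kappa i < kappa j)%O.
Proof.
move=> inj; pose f i := #|[set j | (kappa j < kappa i)%O]|.
have lt_f i : (f i < n)%N.
  rewrite -[ltnRHS]card_ord -cardsT; apply: proper_card.
  by apply/properP; split; [exact: subsetT|exists i; rewrite !inE ?ltxx].
have mono i j : (kappa i < kappa j)%O -> (f i < f j)%N.
  move=> ij; apply: proper_card; apply/properP; split.
    by apply/subsetP => k; rewrite !inE => /lt_trans; apply.
  by exists i; rewrite !inE ?ltxx.
have inj_f : injective (fun i => Ordinal (lt_f i)).
  move=> i j /(congr1 val) /= eqf; apply: inj.
  by case: (ltgtP (kappa i) (kappa j)) => // /mono; rewrite eqf ltnn.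
exists (perm inj_f) => i j; rewrite !permE /=.
case: (ltgtP (kappa i) (kappa j)) => [/mono -> //|/mono|/inj ->]; last by rewrite ltnn.
by move=> /ltnW; rewrite leqNgt => /negbTE.
Qed.

Lemma card_ord_lt (n m : nat) : (m <= n)%N -> #|[set j : 'I_n | (j < m)%N]| = m.
Proof.
by move=> le; rewrite -sum1dep_card -(big_ord_widen n (fun=> 1%N)) // sum1_card card_ord.
Qed.

Lemma card_perm_lt (n : nat) (s : 'S_n) (i : 'I_n) : #|[set j | (s j < s i)%N]| = s i.
Proof.
rewrite -(card_imset _ (@perm_inj _ s)).
have -> : s @: [set j | (s j < s i)%N] = [set j : 'I_n | (j < s i)%N].
  apply/setP => j; rewrite inE; apply/imsetP/idP => [[k]|lt_j]; first by rewrite inE => ? ->.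
  by exists ((s^-1)%g j); rewrite ?inE permKV.
by rewrite card_ord_lt // ltnW.
Qed.

Lemma conv_hull2 (R : realType) (n : nat) (A : set 'rV[R]_n) (x y : 'rV[R]_n) (k : R) :
  0 <= k <= 1 -> conv_hull A x -> conv_hull A y -> conv_hull A (k *: x + (1 - k) *: y).
Proof.
move=> /andP[k0 k1] [m [c [v [Av c0 c1 ->]]]] [m' [c' [v' [Av' c'0 c'1 ->]]]].
exists (m + m')%N, (fun i => match split i with inl j => k * c j | inr j => (1 - k) * c' j end),
  (fun i => match split i with inl j => v j | inr j => v' j end).
have split1 (j : 'I_m) : split (lshift m' j) = inl j by exact: (@unsplitK m m' (inl _ j)).
have split2 (j : 'I_m') : split (rshift m j) = inr j by exact: (@unsplitK m m' (inr _ j)).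
split.
- by move=> i; case: splitP => j _; [exact: Av|exact: Av'].
- by move=> i; case: splitP => j _; apply: mulr_ge0 => //; rewrite subr_ge0.
- rewrite big_split_ord /=.
  under eq_bigr do rewrite split1; under [X in _ + X]eq_bigr do rewrite split2.
  by rewrite -!mulr_sumr c1 c'1; ring.
- rewrite big_split_ord /= !scaler_sumr; congr (_ + _).
  + by apply: eq_bigr => i _; rewrite split1 scalerA.
  + by apply: eq_bigr => i _; rewrite split2 scalerA.
Qed.

Section Rado.
Local Open Scope classical_set_scope.
Context {R : realType} {n : nat}.
Context (q : 'I_n -> R) (q_mono : forall i j : 'I_n, (i < j)%N -> q i < q j).
Implicit Types (x y : 'rV[R]_n) (S T : {set 'I_n}) (i j : 'I_n) (s : 'S_n).

(** As [q] is increasing, this is the least sum of [m] distinct entries, for [m] at most [n]: the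
    bound in Rado's inequalities. *)
Definition bottom_sum (m : nat) : R := \sum_(i < n | (i < m)%N) q i.
Definition subsum x S : R := \sum_(i in S) x 0 i.
Definition vertex s : 'rV[R]_n := \row_j q (s j).
Definition vertices : set 'rV[R]_n := [set vertex s | s in [set: 'S_n]].

Definition rado x : Prop :=
  subsum x [set: 'I_n]%SET = bottom_sum n /\ forall S, bottom_sum #|S| <= subsum x S.

Local Notation beta := bottom_sum.

Lemma bottom_sumS i : beta i.+1 = beta i + q i.
Proof.
rewrite /beta (bigD1 i) //= addrC; congr (_ + _); apply: eq_bigl => j.
by rewrite ltnS ltn_neqAle andbC.
Qed.

(** [S] and the initial segment [M] of the same size have differences of equal size. The entry [q o]
    at index [#|S|] separates them: entries over [M] lie strictly below it, entries outside [M] do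
    not. *)
Lemma bottom_sum_le S : beta #|S| <= \sum_(i in S) q i ?= iff [forall i in S, (i < #|S|)%N].
Proof.
pose M := [set i : 'I_n | (i < #|S|)%N]%SET.
have cardM : #|M| = #|S|.
  have le : (#|S| <= n)%N by rewrite -[leqRHS]card_ord max_card.
  by rewrite card_ord_lt.
have betaM : beta #|S| = \sum_(i in M) q i by apply: eq_bigl => i; rewrite inE.
have [/forall_inP sub|] := boolP [forall i in S, (i < #|S|)%N].
  have -> : S = M.
    by apply/eqP; rewrite eqEcard cardM leqnn andbT; apply/subsetP => i /sub; rewrite inE.
  by split; rewrite cardM betaM ?eqxx.
move=> /forall_inPn[j jS]; rewrite -leqNgt => le_j.
suff lt : beta #|S| < \sum_(i in S) q i by split; rewrite ?ltW // lt_eqF.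
have ltSn : (#|S| < n)%N by rewrite (leq_ltn_trans le_j).
pose o := Ordinal ltSn.
have cardD : #|S :\: M| = #|M :\: S|.
  by have := cardsID M S; have := cardsID S M; rewrite setIC cardM => <- /addnI.
rewrite betaM (big_setID S) /= [ltRHS](big_setID M) /= setIC ltrD2l.
have q_le i : (#|S| <= i)%N -> q o <= q i.
  rewrite leq_eqVlt => /orP[/eqP eqi|/(q_mono (i := o))/ltW//].
  by rewrite (_ : o = i) //; apply/val_inj.
apply: (@lt_le_trans _ _ (\sum_(i in M :\: S) q o)); last first.
  rewrite sumr_const -cardD -sumr_const; apply: ler_sum => i.
  by rewrite !inE -leqNgt => /andP[/q_le].
have [i iMS] : exists i, i \in (M :\: S)%SET.
  apply/set0Pn; rewrite -card_gt0 -cardD card_gt0; apply/set0Pn.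
  by exists j; rewrite !inE jS -leqNgt le_j.
apply: (ltr_sum_one (i := i)) => // [|k].
  by apply: q_mono; move: iMS; rewrite !inE => /andP[].
by rewrite !inE => /andP[_ /(q_mono (j := o))/ltW].
Qed.

Lemma subsum_vertex s S : subsum (vertex s) S = \sum_(i in s @: S) q i.
Proof.
rewrite big_imset /=; last by move=> ? ? _ _; exact: perm_inj.
by apply: eq_bigr => i _; rewrite mxE.
Qed.

Lemma vertex_rado s : rado (vertex s).
Proof.
split => [|S].
  rewrite /subsum (reindex_inj (@perm_inj _ s^-1)) /=; apply: eq_big => i.
    by rewrite inE ltn_ord.
  by rewrite mxE permKV.
rewrite subsum_vertex -(card_imset _ (@perm_inj _ s)); exact: (bottom_sum_le _).1.
Qed.

(** By the equality case of [bottom_sum_le], tightness means that [s] maps [S] onto the initial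
    segment of its size. *)
Lemma vertex_tightP s S :
  reflect (forall i j, i \in S -> j \notin S -> (s i < s j)%N) (subsum (vertex s) S == beta #|S|).
Proof.
rewrite eq_sym subsum_vertex -(card_imset _ (@perm_inj _ s)) (bottom_sum_le _).2.
rewrite card_imset //; last exact: perm_inj.
apply: (iffP forall_inP) => [sub i j iS jS|sub _ /imsetP[i iS ->]].
- have si : (s i < #|S|)%N by rewrite sub ?imset_f.
  rewrite (leq_trans si) // leqNgt; apply/negP => sj.
  have sub' : s @: (j |: S) \subset [set k : 'I_n | (k < #|S|)%N]%SET.
    apply/subsetP => _ /imsetP[k /setU1P[->|kS] ->]; rewrite inE //.
    by rewrite sub ?imset_f.
  have := subset_leq_card sub'; rewrite card_imset; last exact: perm_inj.
  rewrite cardsU1 jS card_ord_lt ?ltnn //.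
  by rewrite -[leqRHS]card_ord max_card.
- rewrite -(card_perm_lt s i); apply: proper_card; apply/properP; split.
    apply/subsetP => j; rewrite inE => lt_j; apply/negPn/negP => jS.
    by have := sub _ _ iS jS; rewrite ltnNge ltnW.
  by exists i; rewrite // inE ltnn.
Qed.

Lemma subsumD x y S : subsum (x + y) S = subsum x S + subsum y S.
Proof. by rewrite -big_split; apply: eq_bigr => i _; rewrite mxE. Qed.

Lemma subsumZ k x S : subsum (k *: x) S = k * subsum x S.
Proof. by rewrite mulr_sumr; apply: eq_bigr => i _; rewrite mxE. Qed.

Lemma subsum_sum (I : Type) (r : seq I) (P : pred I) (F : I -> 'rV[R]_n) S :
  subsum (\sum_(k <- r | P k) F k) S = \sum_(k <- r | P k) subsum (F k) S.
Proof.
by rewrite /subsum exchange_big /=; apply: eq_bigr => i _; rewrite summxE.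
Qed.

Lemma subsumU1 x i S : i \notin S -> subsum x (i |: S) = x 0 i + subsum x S.
Proof. exact: big_setU1. Qed.

Lemma subsumD1 x i S : i \in S -> subsum x S = x 0 i + subsum x (S :\ i).
Proof. exact: big_setD1. Qed.

Lemma subsum0 x : subsum x finset.set0 = 0.
Proof. by rewrite /subsum big_set0. Qed.

Lemma bottom_sum0 : beta 0 = 0.
Proof. by rewrite /beta big_pred0. Qed.

Lemma conv_hull_rado x : conv_hull vertices x -> rado x.
Proof.
move=> [m [c [v [Av c0 c1 ->]]]]; split => [|S]; rewrite subsum_sum.
- rewrite -[RHS]mul1r -c1 mulr_suml; apply: eq_bigr => i _; rewrite subsumZ.
  by case: (Av i) => s _ <-; rewrite (vertex_rado s).1.
- rewrite -[leLHS]mul1r -c1 mulr_suml; apply: ler_sum => i _; rewrite subsumZ.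
  by case: (Av i) => s _ <-; apply: ler_wpM2l (c0 i) _ _ _; exact: (vertex_rado s).2.
Qed.

(** The inequality for [S] with [j] added bounds [x 0 j] below by the entry of [q] at [#|S|]; the
    one for [S] without [i] bounds [x 0 i] above by the preceding entry. *)
Lemma rado_tight_lt x S i j : rado x -> subsum x S = beta #|S| ->
  i \in S -> j \notin S -> x 0 i < x 0 j.
Proof.
move=> [_ xS] tS iS jS.
have cardS := cardsD1 i S; rewrite iS add1n in cardS.
have ltSn : (#|S| < n)%N.
  by have := max_card (mem (j |: S)); rewrite cardsU1 jS card_ord.
have ltSn' : (#|S :\ i| < n)%N by rewrite (leq_trans _ (ltnW ltSn)) // cardS.
have := xS (j |: S); rewrite subsumU1 // cardsU1 jS tS (bottom_sumS (Ordinal ltSn)) /= => le_j.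
have := xS (S :\ i); move: tS.
rewrite (subsumD1 _ iS) cardS (bottom_sumS (Ordinal ltSn')) /= => eqi le_i.
have : q (Ordinal ltSn') < q (Ordinal ltSn) by apply: q_mono; rewrite /= cardS.
by lra.
Qed.

Definition tight_sets x : {set {set 'I_n}} := [set S | subsum x S == beta #|S|]%SET.

Lemma rado_tight0 x : finset.set0 \in tight_sets x.
Proof. by rewrite inE subsum0 cards0 bottom_sum0. Qed.

Lemma rado_tightT x : rado x -> [set: 'I_n]%SET \in tight_sets x.
Proof. by move=> [xT _]; rewrite inE cardsT card_ord xT. Qed.

(* With all pairs of coordinates separated by tight sets, every down-set of the coordinate
   order is tight, which determines the coordinates one after the other. *)
Lemma rado_separated x : rado x ->
    (forall i j, i != j -> exists2 S, S \in tight_sets x & (i \in S) != (j \in S)) ->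
  vertices x.
Proof.
move=> rx sep.
have lt_tight S i j : S \in tight_sets x -> i \in S -> j \notin S -> x 0 i < x 0 j.
  by rewrite inE => /eqP; exact: rado_tight_lt.
have down S : (forall i j, i \in S -> j \notin S -> x 0 i < x 0 j) -> S \in tight_sets x.
  move=> lower; have [->|[i0 i0S]] := set_0Vmem S; first exact: rado_tight0.
  have [full|/existsP[j0 j0S]] := boolP [forall j, j \in S]; last rewrite /= in j0S.
    have -> : S = [set: 'I_n]%SET by apply/setP => j; rewrite inE (forallP full).
    exact: rado_tightT.
  (* The largest coordinate in [S] and the smallest one outside: a tight set that separates them
     must be [S] itself. *)
  pose a := [arg max_(i > i0 in S) x 0 i]%O; pose b := [arg min_(j < j0 | j \notin S) x 0 j]%O.
  have [aS maxa] : a \in S /\ forall i, i \in S -> x 0 i <= x 0 a.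
    by rewrite /a; case: arg_maxP.
  have [bS minb] : b \notin S /\ forall j, j \notin S -> x 0 b <= x 0 j.
    by rewrite /b; case: arg_minP.
  have lt_ab := lower a b aS bS.
  have [|T Tt neT] := sep a b; first by apply: contraTneq lt_ab => ->; rewrite ltxx.
  have [aT bT] : a \in T /\ b \notin T.
    move: neT; case: (boolP (a \in T)) => aT; case: (boolP (b \in T)) => bT // _.
    by have := lt_trans lt_ab (lt_tight _ _ _ Tt bT aT); rewrite ltxx.
  suff -> : S = T by [].
  apply/setP => i; case: (boolP (i \in S)) => iS; case: (boolP (i \in T)) => iT //.
    by have := lt_le_trans (lt_tight _ _ _ Tt aT iT) (maxa i iS); rewrite ltxx.
  by have := lt_le_trans (lt_tight _ _ _ Tt iT bT) (minb i iS); rewrite ltxx.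
have inj : injective (fun i => x 0 i).
  move=> i j eqx; apply/eqP; apply/negPn/negP => /sep[S St].
  case: (boolP (i \in S)) => iS; case: (boolP (j \in S)) => jS // _.
    by have := lt_tight _ _ _ St iS jS; rewrite eqx ltxx.
  by have := lt_tight _ _ _ St jS iS; rewrite eqx ltxx.
have [s ss] := rank_perm inj.
exists s => //; apply/rowP => i; rewrite mxE; symmetry.
(* Both [T] and [i |: T] are down-sets, hence tight; subtracting the two equations gives coordinate
   [i]. *)
pose T := [set j | (s j < s i)%N]%SET.
have Tt : T \in tight_sets x.
  by apply: down => k l; rewrite !inE -leqNgt -ss => lt_k le_l; rewrite (leq_trans lt_k).
have iT : i \notin T by rewrite inE ltnn.
have Tt' : i |: T \in tight_sets x.
  apply: down => k l; rewrite !inE negb_or -leqNgt -ss => lt_k /andP[li le_l].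
  rewrite -(inj_eq (@perm_inj _ s)) -(inj_eq val_inj) in li.
  case/orP: lt_k => [/eqP->|lt_k]; last exact: leq_trans le_l.
  by rewrite ltn_neqAle le_l andbT eq_sym.
move: Tt'; rewrite inE subsumU1 // cardsU1 iT.
move: Tt; rewrite inE card_perm_lt => /eqP -> /eqP.
by rewrite add1n bottom_sumS addrC => /addrI.
Qed.

Definition swap_dir i j : 'rV[R]_n := delta_mx 0 i - delta_mx 0 j.

Lemma subsum_swap_dir i j S : subsum (swap_dir i j) S = (i \in S)%:R - (j \in S)%:R.
Proof.
have delta k : subsum (delta_mx 0 k) S = (k \in S)%:R.
  rewrite /subsum; have [kS|kS] := boolP (k \in S).
    rewrite (bigD1 k) //= mxE !eqxx big1 ?addr0 // => l /andP[_ lk].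
    by rewrite mxE (negbTE lk).
  rewrite big1 // => l lS; rewrite mxE eqxx /=; case: eqP => // lk.
  by move: kS; rewrite -lk lS.
by rewrite /swap_dir subsumD -scaleN1r subsumZ mulN1r !delta.
Qed.

(** Only sets that contain [j] and not [i] lose along [swap_dir i j]. The step is their least slack,
    so the inequalities survive, the minimizing set becomes tight, and the old tight sets, which do
    not separate [i] from [j], stay tight. *)
Lemma rado_move x i j : rado x -> i != j ->
    (forall S, S \in tight_sets x -> (i \in S) = (j \in S)) ->
  exists eps, [/\ 0 < eps, rado (x + eps *: swap_dir i j) &
    tight_sets x \proper tight_sets (x + eps *: swap_dir i j)].
Proof.
move=> rx ij nsep; pose Q S := (i \notin S) && (j \in S).
pose slack S := subsum x S - beta #|S|.
have Qj : Q [set j]%SET by rewrite /Q !inE ij eqxx.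
pose S0 := [arg min_(S < [set j]%SET | Q S) slack S]%O.
have [QS0 minS0] : Q S0 /\ forall S, Q S -> slack S0 <= slack S.
  by rewrite /S0; case: arg_minP.
have subE eps S : subsum (x + eps *: swap_dir i j) S =
    subsum x S + eps * ((i \in S)%:R - (j \in S)%:R).
  by rewrite subsumD subsumZ subsum_swap_dir.
have S0nt : S0 \notin tight_sets x.
  by apply/negP => /nsep; move: QS0 => /andP[/negbTE-> ->].
have slack0 S : 0 <= slack S by rewrite subr_ge0 rx.2.
have slack_gt0 : 0 < slack S0.
  by rewrite lt_neqAle slack0 andbT eq_sym subr_eq0; move: S0nt; rewrite inE.
exists (slack S0); split => //.
- split => [|S]; first by rewrite subE !inE subrr mulr0 addr0 rx.1.
  rewrite subE; have := slack0 S; have := minS0 S.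
  rewrite /Q /slack in slack_gt0 *.
  by case: (i \in S); case: (j \in S) => /=; move: slack_gt0; lra.
- apply/properP; split; last first.
    exists S0 => //; rewrite inE subE; move: QS0 => /andP[/negbTE-> ->] /=.
    by apply/eqP; rewrite /slack; ring.
  apply/subsetP => S St; have := nsep S St; move: St; rewrite !inE subE => /eqP-> ->.
  by rewrite subrr mulr0 addr0.
Qed.

(* A point with two coordinates not separated by a tight set lies between two points that have
   more tight sets. *)
Lemma conv_hull_vertices x : conv_hull vertices x <-> rado x.
Proof.
split; first exact: conv_hull_rado.
have [m] := ubnP #|~: tight_sets x|; elim: m x => // m IH x lt_m rx.
have [/forallP sep|] := boolP [forall i, [forall j, (i != j) ==>
    [exists S in tight_sets x, (i \in S) != (j \in S)]]].
  exists 1%N, (fun=> 1), (fun=> x); split => //; rewrite ?big_ord1 ?scale1r // => _.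
  apply: rado_separated => // i j ij.
  by have /forallP/(_ j)/implyP/(_ ij)/exists_inP := sep i.
move=> /forallPn[i /forallPn[j]]; rewrite negb_imply => /andP[ij /exists_inPn nsep].
have nsep1 S : S \in tight_sets x -> (i \in S) = (j \in S) by move=> /nsep/negPn/eqP.
have nsep2 S : S \in tight_sets x -> (j \in S) = (i \in S) by move=> /nsep1.
have [e1 [e1_gt0 r1 t1]] := rado_move rx ij nsep1.
rewrite eq_sym in ij; have [e2 [e2_gt0 r2 t2]] := rado_move rx ij nsep2.
have lt_card y : tight_sets x \proper tight_sets y -> (#|~: tight_sets y| < m)%N.
  move=> pr; have : (#|~: tight_sets y| < #|~: tight_sets x|)%N.
    by apply: proper_card; rewrite properC.
  lia.
have := conv_hull2 _ (IH _ (lt_card _ t1) r1) (IH _ (lt_card _ t2) r2).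
(* The two points lie at distances proportional to [e1] and [e2] on opposite sides of [x], so this
   weight makes the displacements cancel. *)
move=> /(_ (e2 / (e1 + e2))).
suff -> : e2 / (e1 + e2) *: (x + e1 *: swap_dir i j) +
    (1 - e2 / (e1 + e2)) *: (x + e2 *: swap_dir j i) = x.
  apply; apply/andP; split; first by apply: divr_ge0; lra.
  by rewrite ler_pdivrMr; lra.
by apply/rowP => k; rewrite !mxE; field; lra.
Qed.

End Rado.

(** * Points with prescribed tight constraints *)

Section LowSets.
Context {n : nat} (K : {set 'I_n.-1}).
Implicit Types (S T : {set 'I_n}) (D : {set {set 'I_n}}) (J : {set 'I_n.-1}).

Definition low S : bool := [forall k in K, (posr k \in S) ==> (posl k \in S)].

Definition valid D J : bool :=
  [&& [forall S in D, [&& S != set0, S != setT & low S]],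
      [forall S in D, forall T in D, (S \subset T) || (T \subset S)],
      J \subset K &
      [forall S in D, forall k in J, (posl k \in S) == (posr k \in S)]].

Lemma lowP S : reflect (forall k, k \in K -> posr k \in S -> posl k \in S) (low S).
Proof. exact/'forall_in_implyP. Qed.

Lemma validP D J : reflect
  [/\ forall S, S \in D -> [/\ S != set0, S != setT & low S],
      forall S T, S \in D -> T \in D -> (S \subset T) || (T \subset S),
      forall k, k \in J -> k \in K &
      forall S k, S \in D -> k \in J -> (posl k \in S) = (posr k \in S)]
  (valid D J).
Proof.
apply: (iffP and4P) => [[/forall_inP v1 /forall_inP v2 /subsetP v3 /forall_inP v4]|[v1 v2 v3 v4]].
  split => // [S /v1/and3P[] //|S T /v2/forall_inP SD /SD //|S k /v4/forall_inP SJ /SJ/eqP //].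
split.
- by apply/forall_inP => S /v1/and3P.
- by apply/forall_inP => S SD; apply/forall_inP => T; exact: v2.
- exact/subsetP.
- by apply/forall_inP => S SD; apply/forall_inP => k kJ; rewrite v4.
Qed.

Lemma valid_sub D J D' J' : D' \subset D -> J' \subset J -> valid D J -> valid D' J'.
Proof.
move=> /subsetP sD /subsetP sJ /validP[v1 v2 v3 v4]; apply/validP; split.
- by move=> S /sD/v1.
- by move=> S T /sD SD /sD; exact: v2.
- by move=> k /sJ/v3.
- by move=> S k /sD SD /sJ; exact: v4.
Qed.

End LowSets.

Section Realization.
Context {R : realType} {n : nat}.
Context (q : 'I_n -> R) (q_mono : forall i j : 'I_n, (i < j)%N -> q i < q j).
Implicit Types (x y : 'rV[R]_n) (S T : {set 'I_n}) (i j : 'I_n) (s : 'S_n).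
Implicit Types (V : {set 'S_n}) (D : {set {set 'I_n}}) (J : {set 'I_n.-1}).

Local Notation beta := (bottom_sum q).

Definition avg V : 'rV[R]_n := #|V|%:R^-1 *: \sum_(s in V) vertex q s.

Lemma avgE V i : avg V 0 i = #|V|%:R^-1 * \sum_(s in V) q (s i).
Proof. by rewrite mxE summxE; congr (_ * _); apply: eq_bigr => s _; rewrite mxE. Qed.

Lemma card_inv_gt0 V s : s \in V -> 0 < #|V|%:R^-1 :> R.
Proof. by move=> sV; rewrite invr_gt0 ltr0n card_gt0; apply/set0Pn; exists s. Qed.

Lemma avg_const V s (c : R) : s \in V -> c = #|V|%:R^-1 * \sum_(s in V) c.
Proof.
move=> sV; rewrite sumr_const -[X in _ * X]mulr_natr mulrCA mulVf ?mulr1 //.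
by rewrite -invr_eq0 gt_eqF // (card_inv_gt0 sV).
Qed.

Lemma subsum_avg V S : subsum (avg V) S = #|V|%:R^-1 * \sum_(s in V) subsum (vertex q s) S.
Proof. by rewrite subsumZ subsum_sum. Qed.

Lemma avg_rado V s : s \in V -> rado q (avg V).
Proof.
move=> sV; split => [|S]; rewrite subsum_avg.
  rewrite [RHS](avg_const _ sV); congr (_ * _); apply: eq_bigr => s' _.
  by rewrite (vertex_rado q_mono s').1.
rewrite [leLHS](avg_const _ sV) ler_pM2l ?(card_inv_gt0 sV) //.
by apply: ler_sum => s' _; exact: (vertex_rado q_mono s').2.
Qed.

Lemma avg_lt V i j s : s \in V -> (forall s', s' \in V -> (s' i < s' j)%N) ->
  avg V 0 i < avg V 0 j.
Proof.
move=> sV lt_ij; rewrite !avgE ltr_pM2l ?(card_inv_gt0 sV) //.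
by apply: (ltr_sum_one sV) => [|s' s'V]; [|apply: ltW]; apply: q_mono; exact: lt_ij.
Qed.

Lemma avg_eq V i j : (forall s, s \in V -> (tperm i j * s)%g \in V) ->
  avg V 0 i = avg V 0 j.
Proof.
move=> inv; rewrite !avgE; congr (_ * _).
rewrite (reindex_inj (mulgI (tperm i j))) /=; apply: eq_big => s.
  by apply/idP/idP => [/inv|/inv//]; rewrite mulgA tperm2 mul1g.
by move=> _; rewrite permM tpermL.
Qed.

(** An average of numbers that are all at least a bound attains it only if each of them does. *)
Lemma avg_tight V S s : s \in V ->
  (subsum (avg V) S == beta #|S|) = [forall s in V, subsum (vertex q s) S == beta #|S|].
Proof.
move=> sV; rewrite subsum_avg; apply/eqP/forall_inP => [eqS s' s'V|tS].
- apply/negPn/negP => ne; move: eqS; rewrite [RHS](avg_const _ sV).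
  move=> /(mulfI (lt0r_neq0 (card_inv_gt0 sV)))/esym/eqP; rewrite lt_eqF //.
  apply: (ltr_sum_one s'V) => [|s'' _]; last exact: (vertex_rado q_mono _).2.
  by rewrite lt_neqAle eq_sym ne; exact: (vertex_rado q_mono _).2.
- rewrite [RHS](avg_const _ sV); congr (_ * _); apply: eq_bigr => s' s'V.
  by apply/eqP/tS.
Qed.

Context (K : {set 'I_n.-1}).

(** By [vertex_tightP], these are the permutations whose vertices make every member of [D] tight. *)
Definition block_perms D : {set 'S_n} :=
  [set s : 'S_n | [forall S in D, forall i in S, forall j in ~: S, (s i < s j)%N]].

Definition same_block D i j := [forall S in D, (i \in S) == (j \in S)].

(* Sorting each block by the classes of indices linked by J. *)
Definition sorted_perms D J : {set 'S_n} :=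
  [set s in block_perms D | [forall i, forall j,
    same_block D i j && [exists k in ~: J, (i <= k < j)%N] ==> (s i < s j)%N]].

(** The first average is tight exactly on [D], among proper nonempty sets, but is constant on each
    block. The second separates neighbours within a block at the cuts outside [J] and keeps the
    equalities in [J]. *)
Definition face_point D J : 'rV[R]_n := 2^-1 *: (avg (block_perms D) + avg (sorted_perms D J)).

Lemma block_permsP D s : reflect
  (forall S i j, S \in D -> i \in S -> j \notin S -> (s i < s j)%N) (s \in block_perms D).
Proof.
rewrite inE; apply: (iffP forall_inP) => [sD S i j SD iS jS|sD S SD].
  by have /forall_inP/(_ i iS)/forall_inP := sD S SD; apply; rewrite inE.
by apply/forall_inP => i iS; apply/forall_inP => j; rewrite inE; exact: sD.
Qed.

Lemma same_blockP D i j : reflect (forall S, S \in D -> (i \in S) = (j \in S)) (same_block D i j).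
Proof. exact: 'forall_in_eqP. Qed.

Lemma sorted_permsP D J s : reflect (s \in block_perms D /\ forall i j k, same_block D i j ->
    k \notin J -> (i <= k < j)%N -> (s i < s j)%N) (s \in sorted_perms D J).
Proof.
rewrite [s \in sorted_perms _ _]inE; apply: (iffP andP) => -[sD sJ]; split => //.
  move=> i j k sb kJ kij; have /forallP/(_ j)/implyP := forallP sJ i; apply.
  by rewrite sb /=; apply/exists_inP; exists k; rewrite ?inE.
apply/forallP => i; apply/forallP => j; apply/implyP => /andP[sb /exists_inP[k]].
by rewrite inE => kJ; exact: sJ sb kJ.
Qed.

Lemma sorted_perms_neq0 D J :
    (forall S T, S \in D -> T \in D -> (S \subset T) || (T \subset S)) ->
  exists s, s \in sorted_perms D J.
Proof.
move=> chain; pose blk i := #|[set S in D | i \notin S]|.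
(* [blk] grows from each block to the next along the chain; the term [i], smaller than [n], orders
   each block by index. *)
pose kappa i := (blk i * n + i)%N.
have inj : injective kappa.
  move=> i j /(congr1 (modn^~ n)); rewrite /kappa !modnMDl !modn_small //; exact: val_inj.
have [s ss] := rank_perm inj; exists s.
apply/sorted_permsP; split => [|i j k sb kJ /andP[ik kj]].
- apply/block_permsP => S i j SD iS jS; rewrite ss ltEnat /=.
  have lt_blk : (blk i < blk j)%N.
    apply: proper_card; apply/properP; split; last by exists S; rewrite !inE SD ?iS.
    apply/subsetP => T; rewrite !inE => /andP[TD iT]; rewrite TD /=.
    case/orP: (chain _ _ SD TD) => /subsetP sub; last by apply: contra jS => /sub.
    by rewrite sub in iT.
  have := ltn_ord i; rewrite /kappa; nia.
- rewrite ss ltEnat /=; suff eq_blk : blk i = blk j by rewrite /kappa eq_blk ltn_add2l; lia.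
  apply: eq_card => S; rewrite !inE; have [SD|//] := boolP (S \in D).
  by have /same_blockP -> := sb.
Qed.

Lemma tperm_mem S i j a : (i \in S) = (j \in S) -> (tperm i j a \in S) = (a \in S).
Proof. by case: tpermP => // ->. Qed.

Lemma block_perms_tperm D s i j : same_block D i j -> s \in block_perms D ->
  (tperm i j * s)%g \in block_perms D.
Proof.
move=> /same_blockP sb /block_permsP sD; apply/block_permsP => S a b SD aS bS.
by rewrite !permM; apply: (sD S) => //; rewrite tperm_mem // sb.
Qed.

(** The two swapped indices lie on the same side of every cut [k'] outside [J], so the sorting
    conditions are only permuted. *)
Lemma sorted_perms_tperm D J s k : k \in J -> same_block D (posl k) (posr k) ->
  s \in sorted_perms D J -> (tperm (posl k) (posr k) * s)%g \in sorted_perms D J.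
Proof.
move=> kJ sb /sorted_permsP[sD sJ]; apply/sorted_permsP; split.
  exact: block_perms_tperm.
move=> i j k' sb' k'J /andP[ik kj]; rewrite !permM; apply: (sJ _ _ k' _ k'J).
  apply/same_blockP => S SD; have /same_blockP/(_ S SD) eqk := sb.
  by rewrite !tperm_mem //; exact: (same_blockP _ _ _ sb').
have ne : k != k' :> nat by apply: contraNneq k'J => /val_inj <-.
have le a : (tperm (posl k) (posr k) a <= k')%N = (a <= k')%N.
  by case: tpermP => [->|->|//] /=; lia.
by rewrite le ik ltnNge le -ltnNge.
Qed.

Lemma block_perms_tight D s S : s \in block_perms D -> S \in D ->
  subsum (vertex q s) S = beta #|S|.
Proof.
move=> /block_permsP sD SD; apply/eqP/(vertex_tightP q_mono) => i j; exact: sD.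
Qed.

(** If [S] is tight at [s], swap the index of largest value in [S] with the one of smallest value
    outside. They share a block, since a member of [D] separating them would equal [S]; the swap
    destroys tightness. *)
Lemma block_perms_not_tight D s S : s \in block_perms D ->
    S != set0 -> S != setT -> S \notin D ->
  exists2 s', s' \in block_perms D & subsum (vertex q s') S != beta #|S|.
Proof.
move=> sD S0 ST SD; have [tS|] := boolP (subsum (vertex q s) S == beta #|S|); last by exists s.
have /(vertex_tightP q_mono) sS := tS.
have /set0Pn[i0 i0S] := S0.
have /set0Pn[j0] : ~: S != set0 by rewrite -setCT (inj_eq (can_inj (@setCK _))).
rewrite inE => j0S.
pose i := [arg max_(i > i0 in S) (s i : nat)]%N.
pose j := [arg min_(j < j0 | j \notin S) (s j : nat)]%N.
have [iS maxi] : i \in S /\ forall a, a \in S -> (s a <= s i)%N by rewrite /i; case: arg_maxnP.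
have [jS minj] : j \notin S /\ forall a, a \notin S -> (s j <= s a)%N.
  by rewrite /j; case: arg_minnP.
have sb : same_block D i j.
  apply/negPn/negP => /forall_inPn[T TD neT].
  have lt_T a b : a \in T -> b \notin T -> (s a < s b)%N.
    by move/block_permsP: sD; apply.
  have lt_ij := sS i j iS jS.
  have [iT jT] : i \in T /\ j \notin T.
    move: neT; case: (boolP (i \in T)) => iT; case: (boolP (j \in T)) => jT // _.
    by have := ltn_trans lt_ij (lt_T _ _ jT iT); rewrite ltnn.
  case/negP: SD; suff -> : S = T by [].
  apply/setP => a; case: (boolP (a \in S)) => aS; case: (boolP (a \in T)) => aT //.
    by have := leq_trans (lt_T _ _ iT aT) (maxi a aS); rewrite ltnn.
  by have := leq_trans (lt_T _ _ aT jT) (minj a aS); rewrite ltnn.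
exists (tperm i j * s)%g; first exact: block_perms_tperm.
apply/negP => /(vertex_tightP q_mono)/(_ i j iS jS); rewrite !permM tpermL tpermR.
by have := sS i j iS jS; lia.
Qed.

Lemma face_point_rado D J : valid K D J -> rado q (face_point D J).
Proof.
move=> /validP[_ chain _ _]; have [s sJ] := sorted_perms_neq0 J chain.
have sD : s \in block_perms D by case/sorted_permsP: sJ.
have [e1 l1] := avg_rado sD; have [e2 l2] := avg_rado sJ.
split => [|S]; rewrite subsumZ subsumD; first by rewrite e1 e2; field.
by have := l1 S; have := l2 S; lra.
Qed.

Lemma face_point_tight D J S : valid K D J -> S != set0 -> S != setT ->
  (subsum (face_point D J) S == beta #|S|) = (S \in D).
Proof.
move=> /validP[_ chain _ _] S0 ST; have [s sJ] := sorted_perms_neq0 J chain.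
have sD : s \in block_perms D by case/sorted_permsP: sJ.
have [_ l1] := avg_rado sD; have [_ l2] := avg_rado sJ.
rewrite subsumZ subsumD; have [SD|SD] := boolP (S \in D).
- have /eqP -> : subsum (avg (block_perms D)) S == beta #|S|.
    by rewrite (avg_tight _ sD); apply/forall_inP => s' s'D; rewrite (block_perms_tight s'D).
  have /eqP -> : subsum (avg (sorted_perms D J)) S == beta #|S|.
    rewrite (avg_tight _ sJ); apply/forall_inP => s' /sorted_permsP[s'D _].
    by rewrite (block_perms_tight s'D).
  by apply/eqP; field.
- have [s' s'D nt] := block_perms_not_tight sD S0 ST SD.
  have ne : subsum (avg (block_perms D)) S != beta #|S|.
    by rewrite (avg_tight _ sD); apply/forall_inPn; exists s'.
  apply/negbTE; rewrite gt_eqF //.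
  have := l2 S; have : beta #|S| < subsum (avg (block_perms D)) S.
    by rewrite lt_neqAle eq_sym ne l1.
  lra.
Qed.

(** If [D] separates [posl k] from [posr k], lowness puts [posl k] on the smaller side and both
    averages increase strictly. Otherwise the first average ties them by symmetry, and the second
    ties them for [k] in [J] and sorts them for [k] outside [J]. *)
Lemma face_point_coord D J k : valid K D J -> k \in K ->
  if k \in J then face_point D J 0 (posl k) = face_point D J 0 (posr k)
  else face_point D J 0 (posl k) < face_point D J 0 (posr k).
Proof.
move=> /validP[lowD chain _ DJ] kK; have [s sJ] := sorted_perms_neq0 J chain.
have sD : s \in block_perms D by case/sorted_permsP: sJ.
have fpE i : face_point D J 0 i =
    2^-1 * (avg (block_perms D) 0 i + avg (sorted_perms D J) 0 i).
  by rewrite mxE; congr (_ * _); rewrite mxE.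
rewrite !fpE; have [kJ|kJ] := boolP (k \in J).
  have sb : same_block D (posl k) (posr k) by apply/same_blockP => S SD; exact: DJ.
  rewrite (@avg_eq _ (posl k) (posr k)); last by move=> s'; exact: block_perms_tperm.
  rewrite (@avg_eq (sorted_perms _ _) (posl k) (posr k)) //.
  by move=> s'; exact: sorted_perms_tperm.
rewrite ltr_pM2l ?invr_gt0 //.
have [sb|/forall_inPn[S SD]] := boolP (same_block D (posl k) (posr k)).
  rewrite (@avg_eq _ (posl k) (posr k)); last by move=> s'; exact: block_perms_tperm.
  rewrite ltrD2l; apply: (avg_lt sJ) => s' /sorted_permsP[_ s'J].
  by apply: s'J sb kJ _; rewrite /= leqnn ltnS leqnn.
move=> ne; have [_ _ /lowP/(_ k kK) lowS] := lowD S SD.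
have [kS kS'] : posl k \in S /\ posr k \notin S.
  move: ne lowS; case: (posl k \in S); case: (posr k \in S) => //= _ /(_ isT) //.
have lt s' : s' \in block_perms D -> (s' (posl k) < s' (posr k))%N.
  by move=> /block_permsP s'D; exact: s'D SD kS kS'.
apply: ltrD; first exact: avg_lt sD lt.
by apply: (avg_lt sJ) => s' /sorted_permsP[s'D _]; exact: lt.
Qed.

End Realization.

(** * The h-polynomial as a sum over chains of low sets *)

Section FaceCount.
Local Open Scope classical_set_scope.
Context {R : realType} {n : nat}.
Context (q : 'I_n -> R) (q_mono : forall i j : 'I_n, (i < j)%N -> q i < q j).
Context (K : {set 'I_n.-1}).
Implicit Types (x y : 'rV[R]_n) (S T : {set 'I_n}).

Local Notation beta := (bottom_sum q).
Local Notation I := ({set 'I_n} + 'I_n.-1)%type.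
Implicit Types (t : {set I}) (D : {set {set 'I_n}}) (J : {set 'I_n.-1}).

Definition facet_vec (c : I) : 'rV[R]_n :=
  match c with
  | inl A => \row_j (j \in A)%:R
  | inr k => swap_dir (posr k) (posl k)
  end.

Definition facet_bound (c : I) : R := if c is inl A then beta #|A| else 0.

(** The empty and the full set are left out: their constraints are tight at every point of the
    polytope, which would spoil the link between dimension and number of tight constraints. *)
Definition facet_indices : {set I} :=
  [set c : I | match c with
    | inl A => (A != finset.set0) && (A != [set: 'I_n]%SET)
    | inr k => k \in K
    end]%SET.

Local Notation Q := (hpolytope (const_mx 1) (beta n) facet_vec facet_bound facet_indices).
Local Notation tgt := (tight facet_vec facet_bound facet_indices).

Lemma dotv_facet_vecl S x : dotv (facet_vec (inl S)) x = subsum x S.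
Proof.
rewrite /dotv /subsum [RHS]big_mkcond; apply: eq_bigr => j _ /=.
by rewrite mxE; case: (j \in S); rewrite ?mul1r ?mul0r.
Qed.

Lemma dotv_facet_vecr k x : dotv (facet_vec (inr k)) x = x 0 (posr k) - x 0 (posl k).
Proof.
have delta i : dotv (delta_mx 0 i) x = x 0 i.
  rewrite /dotv (bigD1 i) //= big1 ?addr0 ?mxE ?eqxx ?mul1r // => j ji.
  by rewrite mxE (negbTE ji) andbF mul0r.
by rewrite /= /swap_dir dotvC dotvBr ![dotv x _]dotvC !delta.
Qed.

Lemma dotv_const1 x : dotv (const_mx 1) x = subsum x [set: 'I_n]%SET.
Proof. by rewrite /dotv /subsum; apply: eq_big => j; rewrite ?inE // mxE mul1r. Qed.

Lemma tight_inl x S : (inl S \in tgt x) =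
  [&& S != finset.set0, S != [set: 'I_n]%SET & subsum x S == beta #|S|].
Proof. by rewrite inE dotv_facet_vecl inE andbA. Qed.

Lemma tight_inr x k : (inr k \in tgt x) = (k \in K) && (x 0 (posl k) == x 0 (posr k)).
Proof. by rewrite inE dotv_facet_vecr inE subr_eq0 eq_sym. Qed.

Lemma hpolytopeP x : Q x <-> rado q x /\ forall k, k \in K -> x 0 (posl k) <= x 0 (posr k).
Proof.
split => [[ex cx]|[[ex rx] kx]].
- rewrite dotv_const1 in ex; split => [|k kK]; last first.
    by have := cx (inr k); rewrite dotv_facet_vecr inE subr_ge0 => /(_ kK).
  split => // S; have [->|S0] := eqVneq S finset.set0.
    by rewrite subsum0 cards0 bottom_sum0.
  have [->|ST] := eqVneq S [set: 'I_n]%SET; first by rewrite ex cardsT card_ord.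
  by have := cx (inl S); rewrite dotv_facet_vecl inE S0 ST; apply.
- split => [|[S|k]]; first by rewrite dotv_const1.
    by rewrite dotv_facet_vecl => _; exact: rx.
  by rewrite inE dotv_facet_vecr subr_ge0 => /kx.
Qed.

Lemma part_permutohedron_hpolytope : part_permutohedron (\row_j q j) K = Q.
Proof.
have vE : [set \row_j (\row_j q j) 0 (w j) | w in [set: 'S_n]] = vertices q.
  by congr (_ @` _); apply/funext => w; apply/rowP => j; rewrite !mxE.
have eE x : hyperplaneE (\row_j q j) x <-> subsum x [set: 'I_n]%SET = beta n.
  have -> : subsum x [set: 'I_n]%SET = \sum_i x 0 i by apply: eq_bigl => i; rewrite inE.
  suff -> : beta n = \sum_i (\row_j q j) 0 i by [].
  by apply: eq_big => i; rewrite ?ltn_ord ?mxE.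
apply/seteqP; split => x.
- rewrite /part_permutohedron /permutohedron vE => -[/(conv_hull_vertices q_mono) rx kx].
  by apply/hpolytopeP; split => // k kK; have [] := kx k kK.
- move/hpolytopeP => [rx kx]; split.
    by rewrite /permutohedron vE; apply/(conv_hull_vertices q_mono).
  by move=> k kK; split; [apply/eE; case: rx|exact: kx].
Qed.

Definition lset t : {set {set 'I_n}} := [set S | inl S \in t]%SET.
Definition rset t : {set 'I_n.-1} := [set k | inr k \in t]%SET.

(** At a point, coordinates in a tight set are strictly smaller than those outside, by
    [rado_tight_lt]; this forces lowness, the chain condition and the compatibility with equalities.
    Conversely, [face_point] realizes a valid pair. *)
Lemma realizableP t : realizable (const_mx 1) (beta n) facet_vec facet_bound facet_indices t <->
  valid K (lset t) (rset t).
Proof.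
split => [[x /hpolytopeP[rx kx] <-]|v].
- have lt S i j : S \in lset (tgt x) -> i \in S -> j \notin S -> x 0 i < x 0 j.
    by rewrite inE tight_inl => /and3P[_ _ /eqP]; exact: rado_tight_lt.
  apply/validP; split.
  + move=> S SD; have := SD; rewrite inE tight_inl => /and3P[S0 ST _]; split => //.
    apply/lowP => k kK kS; apply/negPn/negP => kS'.
    by have := lt_le_trans (lt _ _ _ SD kS kS') (kx k kK); rewrite ltxx.
  + move=> S T SD TD; apply/orP.
    have [|/subsetPn[i iS iT]] := boolP (S \subset T); first by left.
    right; apply/subsetP => j jT; apply/negPn/negP => jS.
    by have := lt_trans (lt _ _ _ SD iS jS) (lt _ _ _ TD jT iT); rewrite ltxx.
  + by move=> k; rewrite inE tight_inr => /andP[].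
  + move=> S k SD; rewrite inE tight_inr => /andP[_ /eqP eqk].
    case: (boolP (posl k \in S)) => kS; case: (boolP (posr k \in S)) => kS' //.
      by have := lt _ _ _ SD kS kS'; rewrite eqk ltxx.
    by have := lt _ _ _ SD kS' kS; rewrite eqk ltxx.
- have coord k := face_point_coord q_mono v (k := k).
  have [_ _ JK _] := elimT (validP _ _ _) v.
  have [lowD _ _ _] := elimT (validP _ _ _) v.
  exists (face_point q (lset t) (rset t)).
    apply/hpolytopeP; split; first exact: face_point_rado v.
    by move=> k /coord; case: ifP => _; [move=> ->|move=> /ltW].
  apply/setP => -[S|k]; last first.
    rewrite tight_inr; have [kK|kK] := boolP (k \in K); last first.
      by symmetry; apply: contraNF kK => kt; apply: JK; rewrite inE.
    have := coord k kK; rewrite inE; case: ifP => _ /=; first by move=> ->; rewrite eqxx.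
    by move=> /lt_eqF.
  rewrite tight_inl; have [S0|S0] := eqVneq S finset.set0.
    by symmetry; apply/negP => St; have [] := lowD S; rewrite ?inE ?S0 ?eqxx // -S0.
  have [ST|ST] := eqVneq S [set: 'I_n]%SET.
    by symmetry; apply/negP => St; have [] := lowD S; rewrite ?inE ?ST ?eqxx // -ST.
  by rewrite (face_point_tight q_mono v) // inE.
Qed.

Lemma card_lset_rset t : #|t| = (#|lset t| + #|rset t|)%N.
Proof.
rewrite -!sum1_card big_sumType /=.
by congr (_ + _)%N; apply: eq_bigl => c; rewrite inE.
Qed.

Lemma dim_sum0 : (0 < n)%N ->
  \dim (tight_dir (const_mx 1) facet_vec finset.set0) = n.-1.
Proof.
move=> n0; have -> : tight_dir (const_mx 1) facet_vec finset.set0 =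
    (fullv :&: lker (dotv_lfun (const_mx 1 : 'rV[R]_n)))%VS.
  apply/vspaceP => v; rewrite [RHS]memv_cap memvf memv_ker dotv_lfunE.
  by apply/tight_dirP/eqP => [[]//|ev]; split => // c; rewrite inE.
have := dim_cap_hyperplane fullv (const_mx 1 : 'rV[R]_n).
rewrite dimvf /dim /= mul1n => le1.
apply/eqP; rewrite eqn_leq; apply/andP; split; last by rewrite -ltnS (ltn_predK n0).
rewrite -ltnS (ltn_predK n0) ltn_neqAle; apply/andP; split; last first.
  by rewrite (leq_trans (dimvS (capvSl _ _))) // dimvf /dim /= mul1n.
have sub : (fullv :&: lker (dotv_lfun (const_mx 1 : 'rV[R]_n)) <= fullv)%VS by exact: subvf.
have -> : (\dim (fullv :&: lker (dotv_lfun (const_mx 1 : 'rV[R]_n))) == n) =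
    (\dim (fullv :&: lker (dotv_lfun (const_mx 1 : 'rV[R]_n))) == \dim (@fullv R 'rV[R]_n)).
  by rewrite dimvf /dim /= mul1n.
rewrite (dimv_leqif_eq sub).2; apply/negP => /eqP eqf.
(* The all-ones vector has coordinate sum [n], which is nonzero, so the hyperplane of sum 0 is
   proper. *)
have : (const_mx 1 : 'rV[R]_n) \in (@fullv R 'rV[R]_n) by rewrite memvf.
rewrite -eqf memv_cap memvf memv_ker dotv_lfunE /= => /eqP.
rewrite dotv_const1 /subsum; under eq_bigr do rewrite mxE.
rewrite sumr_const cardsT card_ord => /eqP.
by rewrite pnatr_eq0 -leqn0 leqNgt n0.
Qed.

(** [valid_sub] provides the simplicity needed by [dim_tight_dir], so the face with tight set [t]
    has dimension n - 1 - |t|; [t] is then split into its two kinds of constraints. *)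
Lemma hpoly_valid : (0 < n)%N -> hpoly n.-1 (part_permutohedron (\row_j q j) K) =
  \sum_(DJ | valid K DJ.1 DJ.2) ('X - 1) ^+ (n.-1 - (#|DJ.1| + #|DJ.2|)).
Proof.
move=> n0; rewrite /hpoly part_permutohedron_hpolytope.
pose T := [set t : {set I} | valid K (lset t) (rset t)]%SET.
have TP t : t \in T <-> realizable (const_mx 1) (beta n) facet_vec facet_bound facet_indices t.
  by rewrite inE; split => /realizableP.
have sub (t t' : {set I}) : t' \subset t ->
    realizable (const_mx 1) (beta n) facet_vec facet_bound facet_indices t ->
    realizable (const_mx 1) (beta n) facet_vec facet_bound facet_indices t'.
  move=> /subsetP tt /realizableP vt; apply/realizableP; by apply: (valid_sub _ _ vt);
    apply/subsetP => c; rewrite !inE; exact: tt.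
have dimT t : t \in T -> \dim (tight_dir (const_mx 1) facet_vec t) = (n.-1 - #|t|)%N.
  by move=> /TP/(dim_tight_dir sub)[-> _]; rewrite dim_sum0.
have lt_n (t : {set I}) : (n.-1 - #|t| < n.-1.+1)%N by rewrite ltnS leq_subr.
transitivity (\sum_(t in T) ('X - 1) ^+ (n.-1 - #|t|) : {poly int}).
  rewrite (partition_big (fun t => Ordinal (lt_n t)) xpredT) //=.
  apply: eq_bigr => i _; rewrite (nfaces_hpolytope _ TP) scaler_nat -sumr_const.
  apply: eq_big => t; first by rewrite inE; case: (boolP (t \in T)) => // /dimT ->.
  by rewrite inE => /andP[/dimT -> /eqP ->].
pose h (DJ : {set {set 'I_n}} * {set 'I_n.-1}) : {set I} :=
  [set c : I | match c with inl A => A \in DJ.1 | inr k => k \in DJ.2 end]%SET.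
have hK : cancel h (fun t => (lset t, rset t)).
  by move=> [D J]; congr (_, _); apply/setP => c; rewrite !inE.
have Kh : cancel (fun t => (lset t, rset t)) h.
  by move=> t; apply/setP => -[c|c]; rewrite !inE.
rewrite (reindex_onto h (fun t => (lset t, rset t))) => [|t _]; last exact: Kh.
apply: eq_big => DJ.
  have e := hK DJ; rewrite e eqxx andbT inE.
  by rewrite -[lset _]/((lset (h DJ), rset (h DJ)).1) -[rset _]/((lset (h DJ), rset (h DJ)).2) e.
by rewrite card_lset_rset => /andP[_ /eqP e]; rewrite -[in RHS]e.
Qed.

End FaceCount.

(** Sorting the entries of [p] only permutes the list of vertices and keeps the coordinate sum. *)
Lemma sorted_part_permutohedron (R : realType) (n : nat) (p : 'rV[R]_n) (K : {set 'I_n.-1}) :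
  injective (fun i : 'I_n => p 0 i) ->
  exists2 q : 'I_n -> R, (forall i j : 'I_n, (i < j)%N -> q i < q j) &
    part_permutohedron p K = part_permutohedron (\row_j q j) K.
Proof.
move=> /rank_perm[s ss]; exists (fun i => p 0 ((s^-1)%g i)) => [i j ij|].
  by rewrite -ss !permKV.
have eqE : hyperplaneE p = hyperplaneE (\row_j p 0 ((s^-1)%g j)).
  apply/funext => x; rewrite /hyperplaneE /=; congr (_ = _).
  by rewrite (reindex_inj (@perm_inj _ s^-1%g)); apply: eq_bigr => j _; rewrite mxE.
rewrite /part_permutohedron /halfspace eqE; congr (conv_hull _ `&` _)%classic.
apply/seteqP; split => _ [w _ <-].
  exists (w * s)%g => //; apply/rowP => j; by rewrite !mxE permM permK.
by exists (w * s^-1)%g => //; apply/rowP => j; rewrite !mxE permM.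
Qed.

(** * The recursion for sums over chains *)

Lemma sum_subsets_expr (R : comNzRingType) (I : finType) (F : {set I}) (x y : R) :
  \sum_(J : {set I} | J \subset F) x ^+ #|F :\: J| * y ^+ #|J| = (x + y) ^+ #|F|.
Proof.
rewrite -[RHS]prodr_const [RHS]big_mkcond /=.
(* Each factor becomes a choice between [i] in [J] and [i] outside [J]; off [F] the first option is
   0, which removes every [J] not contained in [F]. *)
have -> : \prod_i (if i \in F then x + y else 1) =
    \prod_i ((if i \in F then y else 0) + (if i \in F then x else 1)).
  by apply: eq_bigr => i _; case: ifP => _; rewrite ?add0r // addrC.
rewrite bigA_distr big_mkcond /=; apply: eq_bigr => J _; case: ifP => [/subsetP sub|]; last first.
  move=> /negbT/subsetPn[i iJ iF]; rewrite (bigD1 i) //= iJ (negbTE iF) mul0r.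
  by [].
rewrite (bigID (mem J)) /= mulrC; congr (_ * _).
- rewrite -prodr_const; apply: eq_bigr => i iJ.
  by rewrite iJ sub.
- rewrite -prodr_const big_mkcond [RHS]big_mkcond; apply: eq_bigr => i _ /=.
  by rewrite inE; case: (i \in J).
Qed.

Section Chains.
Context {n : nat} (K : {set 'I_n.-1}).
Implicit Types (S T A : {set 'I_n}) (D : {set {set 'I_n}}) (J : {set 'I_n.-1}).

Definition linked A : {set 'I_n.-1} := [set k in K | (posl k \in A) && (posr k \in A)].

Lemma posr_inj : injective (@posr n).
Proof. by move=> k l /(congr1 val) /= [] /val_inj. Qed.

(** [posr] injects the linked pairs into [A] without its least element. *)
Lemma linked_lt A : A != set0 -> (#|linked A| < #|A|)%N.
Proof.
move=> /set0Pn[a0 a0A].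
have [a aA mina] : exists2 a, a \in A & forall i, i \in A -> (a <= i)%N.
  by case: (arg_minnP (fun i : 'I_n => i : nat) a0A) => a; exists a.
rewrite -(card_imset _ posr_inj) (cardsD1 a A) aA add1n ltnS; apply: subset_leq_card.
apply/subsetP => _ /imsetP[k kA ->]; move: kA; rewrite !inE => /and3P[_ lA rA].
by rewrite rA andbT; apply: contraTneq (mina _ lA) => <-; rewrite -ltnNge.
Qed.

(** For [S] empty and [D] a chain of proper nonempty low sets, this is the largest [J] that makes
    the pair valid; see [valid_chain_above]. *)
Definition unseparated S D : {set 'I_n.-1} :=
  [set k in linked (~: S) | [forall T in D, (posl k \in T) == (posr k \in T)]].

Definition chain_above S D : bool :=
  [forall T in D, [&& S \proper T, T != setT & low K T]] &&
  [forall T in D, forall U in D, (T \subset U) || (U \subset T)].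

Lemma chain_aboveP S D : reflect
  ((forall T, T \in D -> [/\ S \proper T, T != setT & low K T]) /\
   (forall T U, T \in D -> U \in D -> (T \subset U) || (U \subset T)))
  (chain_above S D).
Proof.
apply: (iffP andP) => -[/= H1 H2]; split.
- by move=> T /(forall_inP H1)/and3P.
- by move=> T U /(forall_inP H2)/forall_inP H /H.
- by apply/forall_inP => T /H1/and3P.
- by apply/forall_inP => T TD; apply/forall_inP => U; exact: H2.
Qed.

Lemma chain_above_min S D : chain_above S D -> D != set0 -> \bigcap_(T in D) T \in D.
Proof.
move=> /chain_aboveP[_ ch] /set0Pn[T0 T0D]; pose U := [arg min_(T < T0 in D) #|T|]%N.
have [UD minU] : U \in D /\ forall T, T \in D -> (#|U| <= #|T|)%N.
  by rewrite /U; case: arg_minnP.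
suff -> : \bigcap_(T in D) T = U by [].
apply/eqP; rewrite eqEsubset bigcap_inf //=; apply/bigcapsP => T TD.
case/orP: (ch _ _ UD TD) => // sub; rewrite -(eqP (_ : T == U)) ?subxx //.
by rewrite eqEcard sub minU.
Qed.

(** Shaped as the index condition that arises in [chain_sum_rec], where chains are grouped by their
    least member [T]. *)
Lemma chain_aboveU1 S T D : low K T ->
  chain_above S (T |: D) && (\bigcap_(U in T |: D) U == T) && (T \notin D) =
  [&& S \proper T, T != setT & chain_above T D].
Proof.
move=> lowT; apply/idP/and3P =>
  [/andP[/andP[/chain_aboveP[H1 H2] /eqP H3] TD]|[ST TT /chain_aboveP[H1 H2]]].
- have [ST TT _] := H1 T (setU11 _ _); split => //; apply/chain_aboveP; split.
    move=> U UD; have [_ UT lowU] := H1 U (setU1r _ UD); split => //.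
    rewrite properEneq; apply/andP; split; first by apply: contraNneq TD => ->.
    by rewrite -H3 bigcap_inf // setU1r.
  by move=> U V UD VD; apply: H2; exact: setU1r.
- have TD : T \notin D by apply/negP => /H1[]; rewrite properxx.
  rewrite TD andbT; apply/andP; split.
    apply/chain_aboveP; split => [U /setU1P[->//|/H1[TU UT lowU]]|U V].
      by split => //; exact: proper_trans TU.
    move=> /setU1P[->|UD] /setU1P[->|VD]; rewrite ?subxx //; last exact: H2.
      by have [/proper_sub ->] := H1 V VD.
    by have [/proper_sub -> _ _] := H1 U UD; rewrite orbT.
  rewrite eqEsubset bigcap_inf ?setU11 //=; apply/bigcapsP => U /setU1P[->//|/H1[]].
  by move/proper_sub.
Qed.

Lemma chain_above_split S D : chain_above S D -> D != set0 ->
  exists T D', [/\ D = T |: D', T \notin D', low K T, S \proper T & T != setT /\ chain_above T D'].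
Proof.
move=> cD D0; have TD := chain_above_min cD D0.
have /chain_aboveP[/(_ _ TD)[STp TT lowT] _] := cD.
exists (\bigcap_(T in D) T), (D :\ \bigcap_(T in D) T); rewrite setD1K // !inE eqxx; split => //.
have : chain_above S D && (\bigcap_(T in D) T == \bigcap_(T in D) T) &&
  (\bigcap_(T in D) T \notin D :\ \bigcap_(T in D) T) by rewrite cD !inE !eqxx.
by rewrite -{1 2}(setD1K TD) chain_aboveU1 // => /and3P[].
Qed.

(** A pair not separated by [T] lies either inside [T :\: S], where no set above [T] can separate
    it, or outside [T]. *)
Lemma unseparated_setU1 S T D : low K T -> S \subset T ->
    (forall U, U \in D -> T \subset U) ->
  #|unseparated S (T |: D)| = (#|linked (T :\: S)| + #|unseparated T D|)%N.
Proof.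
move=> /lowP lowT ST TD.
have -> : unseparated S (T |: D) = linked (T :\: S) :|: unseparated T D.
  apply/setP => k; rewrite !inE; case: (boolP (k \in K)) => //= kK.
  have lowk := lowT k kK.
  have Sk i : i \in S -> i \in T by exact: (subsetP ST).
  apply/andP/orP => [[/andP[lS rS] /forall_inP eqk]|].
  - have /eqP eqT := eqk T (setU11 _ _).
    have [lT|lT] := boolP (posl k \in T); first by left; rewrite lS rS /= -eqT.
    right; rewrite -eqT lT /=; apply/forall_inP => U UD; apply: eqk; exact: setU1r.
  - case=> [/andP[/andP[lS lT] /andP[rS rT]]|/andP[/andP[lT rT] /forall_inP eqk]].
      rewrite lS rS; split => //; apply/forall_inP => U /setU1P[->|/TD/subsetP TU].
        by rewrite lT rT.
      by rewrite !TU.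
    split; first by apply/andP; split; [apply: contra lT|apply: contra rT]; exact: Sk.
    by apply/forall_inP => U /setU1P[->|/eqk//]; rewrite (negbTE lT) (negbTE rT).
rewrite cardsU disjoint_setI0 ?cards0 ?subn0 //.
rewrite -setI_eq0; apply/eqP/setP => k; rewrite !inE.
by apply/negP => /andP[/and3P[_ /andP[_ lT] _] /andP[/and3P[_ /negP]]].
Qed.

Lemma linked_unseparated0 S : unseparated S set0 = linked (~: S).
Proof.
apply/setP => k; rewrite inE andbC; case: (boolP [forall T in set0, _]) => //= /forall_inPn[T].
by rewrite inE.
Qed.

(** This is [linked_lt] summed over the successive differences of the chain. It guarantees that the
    subtractions in the exponents of [chain_sum] are not truncated. *)
Lemma chain_above_bound S D : low K S -> S != setT -> chain_above S D ->
  (#|D| + #|unseparated S D| < #|~: S|)%N.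
Proof.
have [m] := ubnP #|D|; elim: m D S => // m IH D S lt_m lowS ST cD.
have ST0 : ~: S != set0 by rewrite -setCT (inj_eq (can_inj (@setCK _))).
have [->|D0] := eqVneq D set0; first by rewrite cards0 linked_unseparated0 linked_lt.
have [T [D' [eqD TD' lowT STp [TT cD']]]] := chain_above_split cD D0.
move: lt_m; rewrite eqD cardsU1 TD' add1n ltnS => lt_m.
have /chain_aboveP[aboveT _] := cD'.
have := IH D' T lt_m lowT TT cD'.
rewrite unseparated_setU1 ?proper_sub //; last by move=> U /aboveT[/proper_sub].
have : (#|linked (T :\: S)| < #|T :\: S|)%N.
  apply: linked_lt; rewrite setD_eq0; by case/andP: STp.
have : (#|~: S| = #|T :\: S| + #|~: T|)%N.
  rewrite -cardsUI; set X := _ :&: _; have -> : X = set0.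
    by apply/setP => i; rewrite !inE; case: (i \in T); rewrite ?andbF.
  rewrite cards0 addn0; apply: eq_card => i; rewrite !inE.
  by have := subsetP (proper_sub STp) i; case: (i \in S); case: (i \in T) => // /(_ isT).
lia.
Qed.

Context {R : idomainType} (t : R).

(** The sum over [J] is already carried out here, producing the power of [t]. The value 1 at the
    full set is the one that serves the recursion. *)
Definition chain_sum S : R := if S == setT then 1 else
  \sum_(D | chain_above S D)
    (t - 1) ^+ (#|~: S|.-1 - (#|D| + #|unseparated S D|)) * t ^+ #|unseparated S D|.

Lemma valid_chain_above D J : valid K D J = chain_above set0 D && (J \subset unseparated set0 D).
Proof.
apply/validP/andP => [[v1 v2 v3 v4]|[/chain_aboveP[v1 v2] /subsetP v3]].
- split; first by apply/chain_aboveP; split => // S /v1[]; rewrite proper0.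
  apply/subsetP => k kJ; rewrite !inE v3 //=; apply/forall_inP => S SD; exact/eqP/v4.
- split => //.
  + by move=> S /v1[]; rewrite proper0.
  + by move=> k /v3; rewrite !inE => /andP[/andP[]].
  + by move=> S k SD /v3; rewrite !inE => /andP[_ /forall_inP/(_ S SD)/eqP].
Qed.

Lemma sum_valid : (0 < n)%N ->
  \sum_(DJ | valid K DJ.1 DJ.2) (t - 1) ^+ (n.-1 - (#|DJ.1| + #|DJ.2|)) = chain_sum set0.
Proof.
move=> n0; have T0 : (set0 : {set 'I_n}) != setT.
  by apply/eqP => /setP/(_ (Ordinal n0)); rewrite !inE.
have low0 : low K set0 by apply/lowP => k _; rewrite inE.
rewrite /chain_sum (negbTE T0).
under eq_bigl do rewrite valid_chain_above.
rewrite -(pair_big_dep (chain_above set0) (fun D J => J \subset unseparated set0 D)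
  (fun D J => (t - 1) ^+ (n.-1 - (#|D| + #|J|)))) /=.
apply: eq_bigr => D cD; have := chain_above_bound low0 T0 cD.
rewrite setC0 cardsT card_ord; set F := unseparated set0 D => lt.
(* Writing t as (t - 1) + 1 turns its power into the sum over the subsets [J] of [F]. *)
transitivity ((t - 1) ^+ (n.-1 - (#|D| + #|F|)) * (t - 1 + 1) ^+ #|F|); last by rewrite subrK.
rewrite -sum_subsets_expr mulr_sumr; apply: eq_bigr => J sub.
rewrite expr1n mulr1 -exprD; congr (_ ^+ _).
have := cardsD F J; rewrite (setIidPr sub); have := subset_leq_card sub; move: lt n0; clear.
by move: #|F| #|J| #|F :\: J| #|D| => a b c d; lia.
Qed.

(** The empty chain gives the term of the full set; the other chains are grouped by their least
    member [T]. The factor t - 1 on the left supplies the one missing power. *)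
Lemma chain_sum_rec S : low K S -> S != setT ->
  (t - 1) * chain_sum S = \sum_(T | low K T && (S \proper T))
    (t - 1) ^+ (#|T :\: S| - #|linked (T :\: S)|) * t ^+ #|linked (T :\: S)| * chain_sum T.
Proof.
move=> lowS ST.
have ST0 : ~: S != set0 by rewrite -setCT (inj_eq (can_inj (@setCK _))).
have lowT : low K setT by apply/lowP => k _; rewrite !inE.
rewrite {1}/chain_sum (negbTE ST) (bigD1 set0) /=; last first.
  by apply/chain_aboveP; split => T; rewrite inE.
rewrite [RHS](bigD1 setT) /=; last by rewrite lowT properT.
rewrite mulrDr; congr (_ + _).
  rewrite /chain_sum eqxx mulr1 linked_unseparated0 cards0 add0n setTD mulrA -exprS.
  by congr (_ ^+ _ * _); have := linked_lt ST0; move: #|linked _| #|~: S| => a b; lia.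
rewrite (partition_big (fun D => \bigcap_(T in D) T)
  (fun T => low K T && (S \proper T) && (T != setT))) /=; last first.
  move=> D /andP[cD D0]; have /chain_aboveP[/(_ _ (chain_above_min cD D0))[-> -> ->]] := cD.
  by [].
rewrite mulr_sumr; apply: eq_bigr => T /andP[/andP[lT STp] TT].
rewrite /chain_sum (negbTE TT) [in RHS]mulr_sumr mulr_sumr.
rewrite (reindex_onto (fun D => T |: D) (fun D => D :\ T)) /=; last first.
  move=> D /andP[/andP[cD D0] /eqP eqT]; apply: setD1K; rewrite -eqT; exact: chain_above_min cD D0.
apply: eq_big => D.
  have -> : (T |: D) :\ T == D = (T \notin D).
    apply/eqP/idP => [<-|TD]; first by rewrite !inE eqxx.
    exact: setU1K.
  have -> : T |: D != set0 by apply/set0Pn; exists T; exact: setU11.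
  by rewrite andbT chain_aboveU1 // STp TT.
move=> /andP[/andP[/andP[cD _] /eqP eqT] /eqP eqD].
have TD : T \notin D by rewrite -eqD !inE eqxx.
have : [&& S \proper T, T != setT & chain_above T D] by rewrite -chain_aboveU1 // cD eqT eqxx TD.
case/and3P=> _ _ cD'; have /chain_aboveP[aboveT _] := cD'.
rewrite unseparated_setU1 ?proper_sub //; last by move=> U /aboveT[/proper_sub].
rewrite cardsU1 TD add1n exprD !mulrA; congr (_ * _); rewrite -exprS.
rewrite [RHS]mulrAC -exprD; congr (_ ^+ _ * _).
have := chain_above_bound lT TT cD'.
have : (#|linked (T :\: S)| < #|T :\: S|)%N.
  apply: linked_lt; rewrite setD_eq0; by case/andP: STp.
have : (#|~: S| = #|T :\: S| + #|~: T|)%N.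
  rewrite -cardsUI; set X := _ :&: _; have -> : X = set0.
    by apply/setP => i; rewrite !inE; case: (i \in T); rewrite ?andbF.
  rewrite cards0 addn0; apply: eq_card => i; rewrite !inE.
  by have := subsetP (proper_sub STp) i; case: (i \in S); case: (i \in T) => // /(_ isT).
by move: #|linked _| #|unseparated _ _| #|D| #|T :\: S| #|~: T| #|~: S| => a b c d e f; lia.
Qed.

Lemma chain_sum_unique (g : {set 'I_n} -> R) : t != 1 -> g setT = 1 ->
    (forall S, low K S -> S != setT -> (t - 1) * g S = \sum_(T | low K T && (S \proper T))
      (t - 1) ^+ (#|T :\: S| - #|linked (T :\: S)|) * t ^+ #|linked (T :\: S)| * g T) ->
  forall S, low K S -> g S = chain_sum S.
Proof.
move=> t1 gT recg S; have [m] := ubnP #|~: S|; elim: m S => // m IH S lt_m lowS.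
have [->|ST] := eqVneq S setT; first by rewrite gT /chain_sum eqxx.
have t10 : t - 1 != 0 by rewrite subr_eq0.
apply: (mulfI t10); rewrite recg // chain_sum_rec //; apply: eq_bigr => T /andP[lowT STp].
rewrite IH //; have : (#|~: T| < #|~: S|)%N by apply: proper_card; rewrite properC.
by rewrite ltnS in lt_m; move=> /leq_trans; apply.
Qed.

End Chains.

(** * Words weighted by their decreasing runs *)

Section Words.
Context {n : nat} (K : {set 'I_n.-1}).
Implicit Types (S T U A : {set 'I_n}) (x y : 'I_n) (u : seq 'I_n).

(* Adding the letters of u to S one by one yields low sets and ends with the full set. *)
Fixpoint low_word S u : bool :=
  if u is x :: u' then [&& x \notin S, low K (x |: S) & low_word (x |: S) u'] else S == setT.

Definition drops_at (m : nat) u : bool := if u is x :: _ then (x < m)%N else false.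

Context {R : idomainType} (t : R).

(* The product of 1 + t, t and 0 over the maximal strictly decreasing runs of lengths 1, 2 and
   more. *)
Fixpoint run_weight u : R :=
  if u is x :: u1 then
    if u1 is y :: u2 then
      if (y < x)%N then if drops_at y u2 then 0 else t * run_weight u2
      else (1 + t) * run_weight u1
    else 1 + t
  else 1.

(** The run weight with the first run required to have length 1 and its factor 1 + t dropped. *)
Definition tail_weight u : R :=
  if u is x :: u' then if drops_at x u' then 0 else run_weight u' else 0.

(* The sum of z ^ i * run_weight (drop i u) over the i such that the first i letters of u are
   strictly decreasing and smaller than m. *)
Fixpoint prefix_sum (z : R) (m : nat) u : R :=
  run_weight u + (if u is x :: u' then if (x < m)%N then z * prefix_sum z x u' else 0 else 0).

(** The hypothesis is (z + 1)(z + t) = 0. For such z the contributions of the prefixes of a first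
    run of length at least 2 cancel, by induction along the run. *)
Lemma prefix_sum_cons z x u : z ^+ 2 + (1 + t) * z + t = 0 ->
  run_weight (x :: u) + z * prefix_sum z x u = (1 + t + z) * tail_weight (x :: u).
Proof.
move=> zz; elim: u x => [|y u IH] x; first by rewrite /= addr0; ring.
have pE : prefix_sum z x (y :: u) =
    run_weight (y :: u) + if (y < x)%N then z * prefix_sum z y u else 0.
  by [].
have rE : run_weight [:: x, y & u] = if (y < x)%N then if drops_at y u then 0 else t * run_weight u
    else (1 + t) * run_weight (y :: u) by [].
have tE : tail_weight [:: x, y & u] = if (y < x)%N then 0 else run_weight (y :: u) by [].
rewrite pE rE tE; case: ifP => _; last by ring.
rewrite IH /=; case: ifP => _; first by ring.
rewrite mulr0 -[RHS](mul0r (run_weight u)) -zz; ring.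
Qed.

Lemma prefix_sumE z u : z ^+ 2 + (1 + t) * z + t = 0 ->
  prefix_sum z n u = (u == [::])%:R + (1 + t + z) * tail_weight u.
Proof.
move=> zz; case: u => [|x u]; first by rewrite /= mulr0.
have -> : prefix_sum z n (x :: u) = run_weight (x :: u) + z * prefix_sum z x u.
  by rewrite -[LHS]/(run_weight (x :: u) + (if (x < n)%N then _ else _)) ltn_ord.
by rewrite prefix_sum_cons // add0r.
Qed.

(** With [m] the size of the complement of [S], this is the sum of [f] over the low words from [S],
    as [word_sum_rec_tuple] shows; the recursive form suits inductions on the first letter. *)
Fixpoint word_sum_rec (m : nat) S (f : seq 'I_n -> R) : R :=
  if m is m'.+1 then
    \sum_(x | (x \notin S) && low K (x |: S)) word_sum_rec m' (x |: S) (fun u => f (x :: u))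
  else f [::].

Definition word_sum S (f : seq 'I_n -> R) : R := word_sum_rec #|~: S| S f.

Lemma word_sumT f : word_sum setT f = f [::].
Proof. by rewrite /word_sum setCT cards0. Qed.

Lemma cardsCU1 S x : x \notin S -> #|~: S| = #|~: (x |: S)|.+1.
Proof.
move=> xS; rewrite (cardsD1 x (~: S)) in_setC xS add1n; congr _.+1; apply: eq_card => y.
by rewrite !inE negb_or.
Qed.

Lemma word_sumE S f : word_sum S f = (if S == setT then f [::] else 0) +
  \sum_(x | (x \notin S) && low K (x |: S)) word_sum (x |: S) (fun u => f (x :: u)).
Proof.
have [->|ST] := eqVneq S setT.
  by rewrite word_sumT big_pred0 ?addr0 // => x; rewrite inE.
have [x0 x0S] : exists x, x \in ~: S.
  by apply/set0Pn; rewrite -setCT (inj_eq (can_inj (@setCK _))).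
rewrite inE in x0S; rewrite add0r /word_sum (cardsCU1 x0S) /=; apply: eq_bigr => x /andP[xS _].
by have := cardsCU1 x0S; rewrite (cardsCU1 xS) => -[->].
Qed.

Lemma eq_word_sum S f g : f =1 g -> word_sum S f = word_sum S g.
Proof.
rewrite /word_sum; move: #|~: S| => m; elim: m S f g => [|m IH] S f g fg /=; first exact: fg.
by apply: eq_bigr => x _; apply: IH => u; exact: fg.
Qed.

Lemma word_sumD S f g : word_sum S (fun u => f u + g u) = word_sum S f + word_sum S g.
Proof.
rewrite /word_sum; move: #|~: S| => m; elim: m S f g => [//|m IH] S f g /=.
by rewrite -big_split; apply: eq_bigr => x _ /=; rewrite IH.
Qed.

Lemma word_sumZ S c f : word_sum S (fun u => c * f u) = c * word_sum S f.
Proof.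
rewrite /word_sum; move: #|~: S| => m; elim: m S f => [//|m IH] S f /=.
by rewrite mulr_sumr; apply: eq_bigr => x _ /=; rewrite IH.
Qed.

Lemma word_sum0 S : word_sum S (fun=> 0) = 0.
Proof.
rewrite /word_sum; move: #|~: S| => m; elim: m S => [//|m IH] S /=.
by rewrite big1.
Qed.

(** The relation that supports the kernel E(z) of the incidence algebra. *)
Definition antichain_ext S T : bool := [&& S \subset T, low K T & linked K (T :\: S) == set0].

(** The column of F at the full set. *)
Definition run_sum S : R := word_sum S run_weight.

Lemma linked0P A : reflect (forall k, k \in K -> posl k \in A -> posr k \notin A)
  (linked K A == set0).
Proof.
apply: (iffP eqP) => [A0 k kK lA|H].
  apply/negP => rA; have : k \in linked K A by rewrite inE kK lA.
  by rewrite A0 inE.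
apply/setP => k; rewrite !inE; apply/negP => /and3P[kK lA rA].
by have := H k kK lA; rewrite rA.
Qed.

Lemma sum_split_unique (I J : finType) (P : pred I) (Q : J -> pred I) (M : J -> I -> bool)
    (f : I -> R) : (forall i, P i -> exists j, M j i) ->
    (forall i j j', P i -> M j i -> M j' i -> j = j') ->
    (forall i j, P i && M j i = Q j i) ->
  \sum_(i | P i) f i = \sum_j \sum_(i | Q j i) f i.
Proof.
move=> ex uniq PQ; rewrite (exchange_big_dep P) /=; last by move=> j i _; rewrite -PQ => /andP[].
apply: eq_bigr => i Pi; have [j Mj] := ex i Pi.
rewrite (big_pred1 j) // => j'; rewrite -PQ Pi /=; apply/idP/eqP => [Mj'|->//].
exact: uniq Mj' Mj.
Qed.

(** Splits off the largest element [x] of [T :\: S]. Then [x |: S] is low, since a letter linked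
    just below [x] lies in [T] and, by the antichain condition, in [S]. Conversely, [x] is too large
    to be the lower end of a linked pair in [T :\: S]. *)
Lemma antichain_ext_max S T x (m : nat) : low K S ->
  [&& antichain_ext S T, T != S & [forall y in T :\: S, (y < m)%N]] &&
    ((x \in T :\: S) && [forall y in T :\: S, (y <= x)%N]) =
  [&& x \notin S, low K (x |: S) & (x < m)%N] &&
    (antichain_ext (x |: S) T && [forall y in T :\: (x |: S), (y < x)%N]).
Proof.
move=> /lowP lowS; apply/andP/andP.
- case=> /and3P[/and3P[ST /lowP lowT /linked0P anti] TS /forall_inP lt_m].
  move=> /andP[xTS /forall_inP le_x].
  have /setDP[xT xS] := xTS.
  have sub : x |: S \subset T by rewrite subUset sub1set xT.
  split.
    rewrite xS lt_m // andbT; apply/lowP => k kK /setU1P[kx|/(lowS k kK) kS]; last exact: setU1r.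
    rewrite in_setU1; apply/orP; right; apply/negPn/negP => kS.
    have := anti k kK; rewrite !inE kx xT xS kS /= (lowT k kK) ?kx //.
    by move=> /(_ isT).
  apply/andP; split.
    rewrite /antichain_ext sub /=; apply/andP; split; first exact/lowP.
    apply/linked0P => k kK /setDP[kT]; rewrite !inE negb_or => /andP[_ kS].
    by have := anti k kK; rewrite !inE kT kS => /(_ isT); apply: contra => /andP[/norP[_ ->] ->].
  apply/forall_inP => y; rewrite !inE negb_or => /andP[/andP[yx yS] yT].
  by rewrite ltn_neqAle yx le_x // inE yS.
- case=> /and3P[xS /lowP lowx xm] /andP[/and3P[sub lowT /linked0P anti] /forall_inP lt_x].
  have xT : x \in T by rewrite (subsetP sub) // setU11.
  have ST : S \subset T by apply: subset_trans sub; rewrite subsetUr.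
  have le_x y : y \in T :\: S -> (y <= x)%N.
    rewrite !inE => /andP[yS yT]; have [->//|yx] := eqVneq y x.
    by apply/ltnW/lt_x; rewrite !inE negb_or yx yS.
  split; last by rewrite !inE xS xT; apply/forall_inP.
  apply/and3P; split; last first.
  + by apply/forall_inP => y /le_x/leq_ltn_trans; apply.
  + by apply: contraNneq xS => <-.
  rewrite /antichain_ext ST lowT /=; apply/linked0P => k kK lk; apply/negP => rk.
  have := le_x _ rk => /= lt_k.
  have lx : posl k != x by rewrite -(inj_eq val_inj) /= ltn_eqF.
  move: lk rk; rewrite !inE => /andP[lS lT] /andP[rS rT].
  have [rx|rx] := eqVneq (posr k) x.
    by have := lowx k kK; rewrite !inE rx eqxx (negbTE lx) (negbTE lS) => /(_ isT).
  by have := anti k kK; rewrite !inE (negbTE lx) (negbTE rx) lS lT rS rT => /(_ isT).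
Qed.

(* The words out of S that begin with a strictly decreasing arrangement of T \ S, for T
   an antichain extension of S, are grouped by their decreasing prefix. *)
Lemma antichain_run_sum z S (m : nat) : low K S ->
  \sum_(T | antichain_ext S T && [forall y in T :\: S, (y < m)%N]) z ^+ #|T :\: S| * run_sum T =
  word_sum S (prefix_sum z m).
Proof.
have [d] := ubnP #|~: S|; elim: d S m => // d IH S m lt_d lowS.
have extS : antichain_ext S S.
  by rewrite /antichain_ext subxx lowS setDv; apply/linked0P => k; rewrite inE.
have -> : word_sum S (prefix_sum z m) = word_sum S run_weight + word_sum S (fun u =>
    if u is x :: u' then if (x < m)%N then z * prefix_sum z x u' else 0 else 0).
  by rewrite -word_sumD; apply: eq_word_sum => -[|x u].
rewrite (bigD1 S) /=; last by rewrite extS setDv; apply/forall_inP => y; rewrite inE.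
rewrite setDv cards0 mul1r; congr (_ + _).
rewrite word_sumE if_same add0r.
(* The decreasing arrangement of [T :\: S] starts with its largest element, which is the first
   letter [x]. *)
rewrite (@sum_split_unique _ 'I_n _ (fun x T => [&& x \notin S, low K (x |: S) & (x < m)%N] &&
    (antichain_ext (x |: S) T && [forall y in T :\: (x |: S), (y < x)%N]))
  (fun x T => (x \in T :\: S) && [forall y in T :\: S, (y <= x)%N])); first last.
- move=> T x; rewrite -antichain_ext_max //; congr (_ && _).
  by rewrite -andbA; congr (_ && _); rewrite andbC.
- move=> T x y _ /andP[xT /forall_inP lex] /andP[yT /forall_inP ley].
  by apply/val_inj/eqP; rewrite eqn_leq ley // lex.
- move=> T /andP[/andP[/and3P[ST _ _] _] TS].
  have [x0 x0T] : exists x, x \in T :\: S.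
    by apply/set0Pn; rewrite setD_eq0; apply: contra TS => TS; rewrite eqEsubset TS.
  case: (arg_maxnP (fun x : 'I_n => x : nat) x0T) => x xT maxx.
  by exists x; apply/andP; split => //; apply/forall_inP.
rewrite (bigID (fun x => (x \notin S) && low K (x |: S))) /= addrC big1 ?add0r; last first.
  move=> x nx; rewrite big_pred0 // => T; move: nx; case: (x \notin S) => //=.
  by case: (low K (x |: S)).
apply: eq_bigr => x /andP[xS lowx]; rewrite xS lowx /=.
case: (ltnP x m) => xm /=; last first.
  by rewrite big_pred0 // word_sum0.
rewrite word_sumZ -IH //; last by move: lt_d; rewrite (cardsCU1 xS) ltnS.
rewrite mulr_sumr; apply: eq_bigr => T /andP[/and3P[sub _ _] _].
rewrite mulrA -exprS; congr (_ ^+ _ * _).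
rewrite (cardsD1 x (T :\: S)) !inE xS (subsetP sub) ?setU11 // add1n; congr _.+1.
by apply: eq_card => y; rewrite !inE negb_or andbA.
Qed.

(** Used at z = -t, where the factor is 1, and at z = -1, where it is t: E(-t) and E(-1) send
    [run_sum] to the same word sum up to these factors. *)
Lemma antichain_run_sumT z S : z ^+ 2 + (1 + t) * z + t = 0 -> low K S ->
  \sum_(T | antichain_ext S T) z ^+ #|T :\: S| * run_sum T =
  (S == setT)%:R + (1 + t + z) * word_sum S tail_weight.
Proof.
move=> zz lowS; rewrite -word_sumZ.
have -> : (S == setT)%:R + word_sum S (fun u => (1 + t + z) * tail_weight u) =
    word_sum S (prefix_sum z n).
  have -> : (S == setT)%:R = word_sum S (fun u => (u == [::])%:R).
    rewrite word_sumE big1 ?addr0 /=; first by case: ifP.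
    by move=> x _; rewrite word_sum0.
  by rewrite -word_sumD; apply: eq_word_sum => u; rewrite prefix_sumE.
rewrite -antichain_run_sum //; apply: eq_bigl => T.
rewrite andbC; have -> // : [forall y in T :\: S, (y < n)%N].
by apply/forall_inP => y _; exact: ltn_ord.
Qed.

(** The entry C(S, T) of the incidence algebra. *)
Definition step_weight S T : R :=
  (t - 1) ^+ (#|T :\: S| - #|linked K (T :\: S)|) * t ^+ #|linked K (T :\: S)|.

(** The antichain condition on [U :\: T] puts [posl k] in [T]. Adding [posr k] thus gives [T :\: S]
    one more element and, [k] being the largest, exactly one more linked pair, while [U :\: T] loses
    an element: a factor t is gained and a factor -t lost. *)
Lemma step_weight_toggle S U k T : low K S -> low K U -> k \in linked K (U :\: S) ->
    (forall l, l \in linked K (U :\: S) -> (l <= k)%N) -> posr k \notin T ->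
  [&& S \subset T, low K T & antichain_ext T U] =
    [&& S \subset posr k |: T, low K (posr k |: T) & antichain_ext (posr k |: T) U] /\
  ([&& S \subset T, low K T & antichain_ext T U] ->
    step_weight S (posr k |: T) * (- t) ^+ #|U :\: (posr k |: T)| =
    - (step_weight S T * (- t) ^+ #|U :\: T|)).
Proof.
move=> /lowP lowS lowU kUS maxk xT; set x := posr k.
have lowU' := elimT (lowP _ _) lowU.
have [kK lU rU] : [/\ k \in K, posl k \in U :\: S & x \in U :\: S].
  by move: kUS; rewrite inE => /and3P[].
have [/setDP[lU' lS] /setDP[xU xS]] := (lU, rU).
have top l : l \in K -> posl l = x -> posr l \notin U.
  move=> lK lx; apply/negP => rlU; have := maxk l.
  have rlS : posr l \notin S by apply: contra xS => /(lowS l lK); rewrite lx.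
  rewrite !inE lK lx xS xU rlU rlS => /(_ isT); have := congr1 val lx => /= ->.
  by rewrite ltnn.
have unique l : posr l = x -> l = k by move/posr_inj.
have lx : posl k != x by rewrite -(inj_eq val_inj) /= ltn_eqF.
split; first apply/and3P/and3P.
- case=> /subsetP ST /lowP lowT /and3P[/subsetP TU _ /linked0P anti].
  have lT : posl k \in T.
    by apply/negPn/negP => lT; have := anti k kK; rewrite !inE lT lU' xU xT => /(_ isT).
  split; first by apply/subsetP => y /ST; exact: setU1r.
    apply/lowP => l lK /setU1P[/unique->|/(lowT l lK)]; exact: setU1r.
  rewrite /antichain_ext lowU subUset sub1set xU /=; apply/andP; split; first exact/subsetP.
  apply/linked0P => l lK; rewrite !inE !negb_or => /andP[/andP[_ lT'] lU'']; apply/negP.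
  by move=> /andP[/andP[_ rT] rU']; have := anti l lK; rewrite !inE lT' lU'' rT rU' => /(_ isT).
- case=> /subsetP ST /lowP lowT /and3P[/subsetP TU _ /linked0P anti].
  have ST' : S \subset T.
    by apply/subsetP => y yS; case/setU1P: (ST y yS) => // yx; move: xS; rewrite -yx yS.
  have TU' : T \subset U by apply/subsetP => y yT; apply: TU; exact: setU1r.
  split => //.
    apply/lowP => l lK rT; have /setU1P[lx'|//] := lowT l lK (setU1r _ rT).
    by have := top l lK lx'; rewrite (subsetP TU').
  rewrite /antichain_ext TU' lowU /=; apply/linked0P => l lK /setDP[lU'' lT'].
  apply/negP => /setDP[rU' rT].
  have lx' : posl l != x by apply: contraTneq rU' => lx'; exact: top.
  have rx : posr l != x.
    apply: contraNneq lT' => /unique eql; have /setU1P[/eqP|] := lowT k kK (setU11 _ _).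
      by rewrite (negbTE lx).
    by rewrite eql.
  by have := anti l lK; rewrite !inE (negbTE lx') (negbTE rx) lU'' lT' rU' rT => /(_ isT).
- case/and3P=> /subsetP ST /lowP lowT /and3P[/subsetP TU _ /linked0P anti].
  have lT : posl k \in T.
    by apply/negPn/negP => lT; have := anti k kK; rewrite !inE lT lU' xU xT => /(_ isT).
  have eqL : linked K ((x |: T) :\: S) = k |: linked K (T :\: S).
    apply/setP => l; rewrite in_setU1 !inE; have [->|lk] := eqVneq l k.
      by rewrite kK lT lS xS eqxx orbT.
    have rx : posr l != x by apply: contraNneq lk => /unique ->.
    rewrite (negbTE rx) /=; case: (boolP (l \in K)) => //= lK.
    have [lx'|//] := eqVneq (posl l) x.
    rewrite lx' xS /= (negbTE xT) /=; apply/negP => /andP[_ /TU].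
    by apply/negP; exact: top.
  have kT : k \notin linked K (T :\: S) by rewrite !inE -/x (negbTE xT) !andbF.
  have card1 : #|(x |: T) :\: S| = #|T :\: S|.+1.
    rewrite (cardsD1 x) !inE eqxx xS /= add1n; congr _.+1; apply: eq_card => y; rewrite !inE.
    have [->|//] := eqVneq y x; by rewrite (negbTE xT) andbF.
  have card2 : #|U :\: T| = #|U :\: (x |: T)|.+1.
    rewrite (cardsD1 x) !inE xT xU /= add1n; congr _.+1; apply: eq_card => y.
    by rewrite !inE negb_or andbA.
  rewrite /step_weight eqL cardsU1 kT card1 card2 add1n subSS !exprS; ring.
Qed.

(* Toggling the largest upper end of a linked pair in T cancels all terms, unless U \ S is an
   antichain; then the sum is a binomial expansion. *)
Lemma sum_step_weight S U : low K S -> low K U -> S \subset U ->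
  \sum_(T : {set 'I_n} | [&& S \subset T, low K T & antichain_ext T U])
    step_weight S T * (- t) ^+ #|U :\: T| =
  if linked K (U :\: S) == set0 then (- 1) ^+ #|U :\: S| else 0.
Proof.
move=> lowS lowU SU; case: ifPn => [anti|/set0Pn[k0 k0US]].
- have /linked0P anti' := anti.
  (* Every set between [S] and [U] is admissible here, so the sum runs over all subsets [J] of
     [U :\: S], none of which contains a linked pair. *)
  have -> : (- 1 : R) = - t + (t - 1) by ring.
  rewrite -sum_subsets_expr (reindex_onto (fun J => S :|: J) (fun T => T :\: S)) /=; last first.
    move=> T /and3P[ST _ _]; apply/setP => y; rewrite !inE.
    by have := subsetP ST y; case: (y \in S) => // /(_ isT) ->.
  apply: eq_big => J.
    apply/andP/idP => [[/and3P[_ _ /and3P[SJU _ _]] /eqP <-]|JU].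
      exact: setSD.
    have JU' : J \subset U by apply: subset_trans JU (subsetDl _ _).
    split; last first.
      apply/eqP/setP => y; have := subsetP JU y; rewrite !inE.
      by case: (y \in S); case: (y \in J) => // /(_ isT).
    rewrite subsetUl /=; apply/andP; split.
      apply/lowP => l lK /setUP[rS|rJ]; rewrite inE; first by rewrite (elimT (lowP _ _) lowS).
      have /setDP[rU rS] := subsetP JU _ rJ.
      have lU := elimT (lowP _ _) lowU l lK rU.
      apply/orP; left; apply/negPn/negP => lS.
      by have := anti' l lK; rewrite !inE lS lU rU rS => /(_ isT).
    rewrite /antichain_ext subUset SU JU' lowU /=; apply/linked0P => l lK.
    rewrite !inE !negb_or => /andP[/andP[lS _] lU]; apply/negP => /andP[/andP[rS _] rU].
    by have := anti' l lK; rewrite !inE lS lU rU rS => /(_ isT).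
  move=> /andP[/and3P[_ _ /and3P[SJU _ _]] /eqP eqJ].
  have JU : J \subset U :\: S by rewrite -eqJ; exact: setSD.
  have L0 : linked K J = set0.
    apply/eqP/linked0P => l lK /(subsetP JU) lJ; apply: contra (anti' l lK lJ); exact: (subsetP JU).
  rewrite /step_weight eqJ L0 cards0 subn0 mulr1 mulrC; congr (_ ^+ _ * _).
  by rewrite setDDl setUC.
- have [k kUS maxk] : exists2 k, k \in linked K (U :\: S) &
      forall l, l \in linked K (U :\: S) -> (l <= k)%N.
    by case: (arg_maxnP (fun l : 'I_n.-1 => l : nat) k0US) => k; exists k.
  have tog T := @step_weight_toggle S U k T lowS lowU kUS maxk.
  rewrite (bigID (fun T => posr k \in T)) /=.
  rewrite (reindex_onto (fun T => posr k |: T) (fun T => T :\ posr k)) /=; last first.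
    by move=> T /andP[_]; exact: setD1K.
  apply/eqP; rewrite addr_eq0 -sumrN; apply/eqP.
  have eqP' T : [&& S \subset posr k |: T, low K (posr k |: T) & antichain_ext (posr k |: T) U] &&
      (posr k \in posr k |: T) && ((posr k |: T) :\ posr k == T) =
      [&& S \subset T, low K T & antichain_ext T U] && (posr k \notin T).
    rewrite setU11 andbT; have -> : ((posr k |: T) :\ posr k == T) = (posr k \notin T).
      by apply/eqP/idP => [<-|xT]; [rewrite !inE eqxx|exact: setU1K].
    by case: (boolP (posr k \in T)) => xT; rewrite ?andbF // !andbT (tog T xT).1.
  apply: eq_big => T; first exact: eqP'.
  by rewrite eqP' => /andP[PT xT]; exact: (tog T xT).2.
Qed.

Definition tail_sum S : R := (S == setT)%:R + word_sum S tail_weight.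

(** Applying C E(-t) = E(-1) to [run_sum], the sum over all low [T] containing [S] is t times
    [tail_sum S]. The term [T = S] has weight 1; moving it across leaves t - 1. *)
Lemma tail_sum_rec S : low K S -> S != setT -> (t - 1) * tail_sum S =
  \sum_(T | low K T && (S \proper T)) step_weight S T * tail_sum T.
Proof.
move=> lowS ST.
have tailE T : low K T -> tail_sum T = \sum_(U | antichain_ext T U) (- t) ^+ #|U :\: T| * run_sum U.
  by move=> lowT; rewrite antichain_run_sumT //; [congr (_ + _)|]; ring.
have all : \sum_(T | low K T && (S \subset T)) step_weight S T * tail_sum T = t * tail_sum S.
  transitivity (\sum_(U | antichain_ext S U) (- 1) ^+ #|U :\: S| * run_sum U).
    under eq_bigr => T /andP[lowT _] do rewrite tailE // mulr_sumr.
    rewrite (exchange_big_dep (fun U => low K U && (S \subset U))) /=; last first.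
      by move=> T U /andP[_ ST'] /and3P[TU -> _]; rewrite (subset_trans ST').
    rewrite [RHS]big_mkcond [LHS]big_mkcond; apply: eq_bigr => U _.
    rewrite /antichain_ext andbCA; case: (boolP (low K U)) => //= lowU.
    case: (boolP (S \subset U)) => //= SU.
    transitivity ((\sum_(T : {set 'I_n} | [&& S \subset T, low K T & antichain_ext T U])
        step_weight S T * (- t) ^+ #|U :\: T|) * run_sum U).
      rewrite mulr_suml; apply: eq_big => T; last by rewrite mulrA.
      by rewrite /antichain_ext ?lowU; case: (low K T); case: (S \subset T).
    by rewrite sum_step_weight //; case: ifP; rewrite ?mul0r.
  by rewrite antichain_run_sumT // /tail_sum ?(negbTE ST) /=; ring.
move: all; rewrite (bigD1 S) /=; last by rewrite lowS subxx.
rewrite {1}/step_weight setDv.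
have -> : linked K set0 = set0.
  by apply/eqP/linked0P => l _; rewrite inE.
rewrite !cards0 !expr0 !mul1r => all.
have -> : \sum_(T | low K T && (S \proper T)) step_weight S T * tail_sum T =
    \sum_(T | low K T && (S \subset T) && (T != S)) step_weight S T * tail_sum T.
  apply: eq_bigl => T; rewrite properEneq eq_sym -andbA; congr (_ && _); exact: andbC.
by rewrite mulrBl mul1r -all addrAC subrr add0r.
Qed.

Lemma tail_sum_chain_sum S : t != 1 -> low K S -> tail_sum S = chain_sum K t S.
Proof.
move=> t1; apply: chain_sum_unique => //; last exact: tail_sum_rec.
by rewrite /tail_sum eqxx word_sumT addr0.
Qed.

End Words.

(** * Minimal coset representatives as words *)

Section MinimalRepresentatives.
Context {n : nat} (K : {set 'I_n.-1}).
Implicit Types (w u v : 'S_n) (k l : 'I_n.-1) (x y i j : 'I_n).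

Lemma tperm_adj_inv k x y : (x < y)%N ->
    (tperm (posl k) (posr k) y < tperm (posl k) (posr k) x)%N ->
  x = posl k /\ y = posr k.
Proof.
have val_tperm z : tperm (posl k) (posr k) z =
    (if z == k :> nat then k.+1 else if z == k.+1 :> nat then k : nat else z) :> nat.
  case: tpermP => [->|->|/eqP zl /eqP zr] /=; first by rewrite eqxx.
    by rewrite eqxx (gtn_eqF (ltnSn _)).
  by rewrite -!(inj_eq val_inj) /= in zl zr; rewrite (negbTE zl) (negbTE zr).
rewrite !val_tperm => xy lt_s.
suff [xk yk] : x = k :> nat /\ y = k.+1 :> nat by split; apply/val_inj.
by move: lt_s; case: eqP; case: eqP; try case: eqP; try case: eqP; lia.
Qed.

(** No generator of the subgroup moves a letter across a cut [k] outside [K]. *)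
Lemma WK_subgroup_le u k x : u \in WK_subgroup K -> k \notin K -> (u x <= k)%N = (x <= k)%N.
Proof.
move=> /gen_prodgP[m [c cK ->]] kK; move: x.
apply: (big_ind (fun v : 'S_n => forall x, (v x <= k)%N = (x <= k)%N)) => [x|v1 v2 H1 H2 x|i _ x].
- by rewrite perm1.
- by rewrite permM H2 H1.
- have /imsetP[l lK ->] := cK i; have kl : k != l :> nat by apply: contraNneq kK => /val_inj ->.
  by case: tpermP => [->|->|//] /=; lia.
Qed.

(** If [posr k] stands before [posl k], swapping these two letters removes an inversion and creates
    none. Conversely, under the order condition, every inversion of [w] persists in all elements of
    its coset. *)
Lemma WK_P w : reflect
  (forall k, k \in K -> ((w^-1)%g (posl k) < (w^-1)%g (posr k))%N) (w \in WK K).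
Proof.
rewrite inE; apply: (iffP forall_inP) => [minw k kK|incr v /lcosetP[u uK ->]].
- rewrite ltnNge; apply/negP; rewrite leq_eqVlt => /orP[/eqP/val_inj/perm_inj/eqP|lt].
    by rewrite -(inj_eq val_inj) /= gtn_eqF.
  set s := tperm (posl k) (posr k).
  have : (perm_length (w * s)%g < perm_length w)%N; last first.
    rewrite ltnNge minw //; apply/lcosetP; exists s => //.
    by apply: mem_gen; apply/imsetP; exists k.
  apply: proper_card; apply/properP; split.
    apply/subsetP => -[i j]; rewrite !inE /= !permM => /andP[ij lt_s]; rewrite ij /=.
    rewrite ltnNge leq_eqVlt; apply/negP => /orP[/eqP/val_inj/perm_inj eqij|wij].
      by rewrite eqij ltnn in ij.
    have [eqi eqj] := tperm_adj_inv wij lt_s; move: lt.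
    by rewrite -eqi -eqj !permK ltnNge ltnW.
  exists ((w^-1)%g (posr k), (w^-1)%g (posl k)); rewrite !inE /= ?permM !permKV lt /=.
    by [].
  by rewrite tpermL tpermR -leqNgt ltnW.
- apply: subset_leq_card; apply/subsetP => -[i j]; rewrite !inE /= !permM => /andP[ij wji].
  rewrite ij /=; have [|all] := boolP [exists k, (k \notin K) && (w j <= k < w i)%N].
    move=> /existsP[k /and3P[kK jk ki]].
    rewrite (@leq_ltn_trans k) //; first by rewrite (WK_subgroup_le _ uK).
    by rewrite ltnNge (WK_subgroup_le _ uK) // -ltnNge.
  (* If all cuts between the letters [w j] and [w i] were in [K], these letters would appear in
     increasing order of position, against [i < j]. *)
  have mono m x y : (x + m = y)%N -> (w j <= x)%N -> (y <= w i)%N ->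
      ((w^-1)%g x <= (w^-1)%g y)%N.
    elim: m y => [|m IH] y; first by rewrite addn0 => /val_inj ->.
    rewrite addnS => eqy jx yi.
    have lt_m : (x + m < n.-1)%N by have := ltn_ord y; lia.
    pose k := Ordinal lt_m.
    have eqr : posr k = y by apply/val_inj.
    have kK : k \in K.
      move: all => /existsPn/(_ k); rewrite negb_and negbK => /orP[//|].
      by rewrite /= (leq_trans jx) ?leq_addr //= -ltnNge; lia.
    apply: leq_trans (IH (posl k) _ jx _) _ => //=; first by lia.
    by rewrite -eqr ltnW // incr.
  have := mono (w i - w j)%N (w j) (w i); rewrite subnKC ?(ltnW wji) // !permK leqnn.
  by move=> /(_ erefl isT (leqnn _)); rewrite leqNgt ij.
Qed.

End MinimalRepresentatives.

Section WordsOfPermutations.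
Context {n : nat} (K : {set 'I_n.-1}) {R : idomainType}.
Implicit Types (S : {set 'I_n}) (w : 'S_n) (u : seq 'I_n).

Lemma low_wordP S u : low K S -> reflect
  [/\ uniq u, forall x, (x \in u) = (x \notin S) &
    forall k, k \in K -> posr k \in u -> (posl k \in S) || (index (posl k) u < index (posr k) u)%N]
  (low_word K S u).
Proof.
elim: u S => [|x u IH] S lowS /=.
  apply: (iffP eqP) => [->|[_ mem _]]; first by split => // x; rewrite inE.
  by apply/setP => x; have := mem x; rewrite !inE => /esym/negbFE.
have lr (k : 'I_n.-1) : posl k != posr k by rewrite -(inj_eq val_inj) /= ltn_eqF.
apply: (iffP and3P) => [[xS lowx /(IH _ lowx)[uniq_u mem idx]]|[/andP[xu uniq_u] mem idx]].
- have xu : x \notin u by rewrite mem !inE eqxx.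
  split => [|y|k kK]; first by rewrite xu.
    rewrite inE mem !inE negb_or; have [->|//] := eqVneq y x; by rewrite xS.
  rewrite inE => /orP[/eqP rx|rk].
    have := elimT (lowP _ _) lowx k kK; rewrite !inE rx eqxx => /(_ isT).
    by rewrite -rx (negbTE (lr k)) => /= ->.
  have := idx k kK rk; rewrite !inE; have [<-|lx] := eqVneq (posl k) x.
    by rewrite /= (negbTE (lr k)) orbT.
  rewrite /=; have [rx|rx] := eqVneq x (posr k); last by rewrite ltnS.
  by move: rk; rewrite -rx (negbTE xu).
- have xS : x \notin S by rewrite -mem inE eqxx.
  have lowx : low K (x |: S).
    apply/lowP => k kK; rewrite !inE => /orP[/eqP rx|/(elimT (lowP _ _) lowS k kK) ->]; last first.
      by rewrite orbT.
    have := idx k kK; rewrite inE rx eqxx => /(_ isT) /= /orP[->|]; first by rewrite orbT.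
    by rewrite ltn0.
  split => //; apply/(IH _ lowx); split => // [y|k kK rk].
    have := mem y; rewrite !inE negb_or; have [->|//] := eqVneq y x; by rewrite (negbTE xu).
  have := idx k kK; rewrite inE rk orbT => /(_ isT); rewrite !inE /=.
  have [//|lx] := eqVneq x (posl k).
  have [rx|rx] := eqVneq x (posr k); first by rewrite rx rk in xu.
  by rewrite ltnS => /orP[->|->]; rewrite ?orbT.
Qed.

Lemma word_sum_rec_tuple (m : nat) S (f : seq 'I_n -> R) : #|~: S| = m ->
  word_sum_rec K m S f = \sum_(u : m.-tuple 'I_n | low_word K S u) f u.
Proof.
elim: m S f => [|m IH] S f cardS /=.
  have -> : S = setT.
    by apply: (can_inj (@setCK _)); rewrite setCT; apply/eqP; rewrite -cards_eq0 cardS.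
  rewrite (big_pred1 [tuple]) // => u; by rewrite tuple0 /= !eqxx.
pose h (xu : 'I_n * m.-tuple 'I_n) : m.+1.-tuple 'I_n := [tuple of xu.1 :: xu.2].
have hK : cancel h (fun u : m.+1.-tuple 'I_n => (thead u, [tuple of behead u])).
  by move=> [x u]; congr (_, _); apply/val_inj.
have Kh : cancel (fun u : m.+1.-tuple 'I_n => (thead u, [tuple of behead u])) h.
  by move=> u; rewrite /h [RHS]tuple_eta.
rewrite (reindex h) /=; last exact: (onW_bij _ (Bijective hK Kh)).
under eq_bigr => x /andP[xS _].
  rewrite IH; last by move: cardS; rewrite (cardsCU1 xS) => -[].
  over.
by rewrite pair_big_dep; apply: eq_bigl => -[x u] /=; rewrite andbA.
Qed.

Definition perm_word w : n.-tuple 'I_n := [tuple w i | i < n].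

Lemma perm_wordE w : perm_word w = [seq w i | i <- enum 'I_n] :> seq 'I_n.
Proof. by []. Qed.

Lemma perm_word_inj : injective perm_word.
Proof.
move=> w v eqw; apply/permP => i.
by have := congr1 (fun u : n.-tuple _ => tnth u i) eqw; rewrite !tnth_mktuple.
Qed.

Lemma index_perm_word w x : index x (perm_word w) = (w^-1)%g x.
Proof.
by rewrite perm_wordE -{1}(permKV w x) index_map ?index_enum_ord //; exact: perm_inj.
Qed.

Lemma mem_perm_word w x : x \in tval (perm_word w).
Proof. by rewrite perm_wordE -(permKV w x) map_f ?mem_enum. Qed.

Lemma low_set0 : low K set0.
Proof. by apply/lowP => k _; rewrite inE. Qed.

Lemma low_word_perm w : low_word K set0 (perm_word w) = (w \in WK K).
Proof.
apply/(low_wordP _ low_set0)/WK_P => [[_ _ idx] k kK|incr].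
  by have := idx k kK (mem_perm_word _ _); rewrite inE !index_perm_word.
split => [|x|k kK _]; last by rewrite !index_perm_word incr ?orbT.
  by rewrite perm_wordE map_inj_uniq ?enum_uniq //; exact: perm_inj.
by rewrite mem_perm_word inE.
Qed.

(** A low word from the empty set uses each letter once, so it is the one-line notation of a
    permutation, and lowness at each step is the order condition of [WK_P]. *)
Lemma word_sum_perm (f : seq 'I_n -> R) :
  word_sum K set0 f = \sum_(w in WK K) f (perm_word w).
Proof.
have card0 : #|~: (set0 : {set 'I_n})| = n by rewrite setC0 cardsT card_ord.
rewrite /word_sum card0 (word_sum_rec_tuple _ card0).
rewrite -(@big_imset _ _ _ _ _ perm_word _ (fun u : n.-tuple 'I_n => f u)) /=; last first.
  by move=> w v _ _; exact: perm_word_inj.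
apply: eq_bigl => u; apply/idP/imsetP => [lu|[w wK ->]]; last by rewrite low_word_perm.
have [uniq_u mem _] := elimT (low_wordP _ low_set0) lu.
have inj : injective (tnth u) by move=> i j /tuple_uniqP; apply.
have eqp : u = perm_word (perm inj).
  by apply/eq_from_tnth => i; rewrite tnth_mktuple permE.
by exists (perm inj); rewrite // -low_word_perm -eqp.
Qed.

End WordsOfPermutations.

(** * Run weights expressed by descents *)

Section DescentWeights.
Context {R : idomainType} (t : R).
Implicit Types b : seq bool.

Definition nodd_rel (b1 b2 : bool) : bool := ~~ (b1 && b2).

Definition descent_bits (n : nat) (u : seq 'I_n) : seq bool :=
  if u is x :: u' then pairmap (fun x y : 'I_n => (y < x)%N) x u' else [::].

(** Two adjacent entries are never both [true]. The bounds keep truncated exponents exact in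
    [run_weightE] and yield [des_tilde_le]. *)
Lemma count_sorted b : sorted nodd_rel b ->
  ((count id b).*2 <= (size b).+1)%N /\ (~~ head false b -> (count id b).*2 <= size b)%N.
Proof.
elim: b => [//|b0 b IH] /= path_b; have [le1 le2] := IH (path_sorted path_b).
case: b0 path_b => /= path_b; split => //; rewrite ?add0n ?add1n ?doubleS //.
  rewrite !ltnS; apply: le2; by case: (b) path_b => [//|[] b'].
exact: leqW.
Qed.

(** Without double descents, the descents count the runs of length 2, and the letters left over are
    the runs of length 1. Induction is on the length because a run of length 2 consumes two
    letters. *)
Lemma run_weightE (n : nat) (x : 'I_n) (u : seq 'I_n) :
  run_weight t (x :: u) = if sorted nodd_rel (descent_bits (x :: u)) then
    t ^+ count id (descent_bits (x :: u)) *
    (1 + t) ^+ ((size u).+1 - (count id (descent_bits (x :: u))).*2) else 0.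
Proof.
have [m] := ubnP (size u); elim: m x u => // m IH x [|y u] lt_m; first by rewrite /= mul1r.
have rE : run_weight t [:: x, y & u] = if (y < x)%N then if drops_at y u then 0
  else t * run_weight t u else (1 + t) * run_weight t (y :: u) by [].
rewrite rE; have lt_u : ((size u).+1 < m.+1)%N := lt_m.
have bE : descent_bits [:: x, y & u] = (y < x)%N :: descent_bits (y :: u) by [].
rewrite bE; case: (y < x)%N; last first.
  rewrite IH //=; have -> : path nodd_rel false (pairmap (fun x y : 'I_n => (y < x)%N) y u) =
     sorted nodd_rel (pairmap (fun x y : 'I_n => (y < x)%N) y u).
    by case: (pairmap _ _ _).
  case: ifP => // srt; last by rewrite mulr0.
  have [le1 _] := count_sorted srt; rewrite size_pairmap in le1.
  by rewrite add0n [in RHS]subSn // [in RHS]exprS mulrCA.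
case: u lt_m lt_u {rE bE} => [|z u] lt_m lt_u; first by rewrite /= mulr1.
have -> : descent_bits [:: y, z & u] = (z < y)%N :: descent_bits (z :: u) by [].
rewrite [drops_at _ _]/=; case: (z < y)%N; first by [].
rewrite IH /=; last exact: ltnW.
have -> : path nodd_rel false (pairmap (fun x y : 'I_n => (y < x)%N) z u) =
   sorted nodd_rel (pairmap (fun x y : 'I_n => (y < x)%N) z u).
  by case: (pairmap _ _ _).
by case: ifP => // _; rewrite ?mulr0 // add0n add1n exprS doubleS !subSS mulrA.
Qed.

Lemma tail_weightE (n : nat) (x : 'I_n) (u : seq 'I_n) :
  tail_weight t (x :: u) =
    if sorted nodd_rel (descent_bits (x :: u)) && ~~ head false (descent_bits (x :: u)) then
    t ^+ count id (descent_bits (x :: u)) *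
    (1 + t) ^+ (size u - (count id (descent_bits (x :: u))).*2) else 0.
Proof.
case: u => [|y u]; first by rewrite /= mul1r.
have -> : tail_weight t [:: x, y & u] = if (y < x)%N then 0 else run_weight t (y :: u) by [].
have -> : descent_bits [:: x, y & u] = (y < x)%N :: descent_bits (y :: u) by [].
case: (y < x)%N; first by rewrite andbF.
rewrite run_weightE /= andbT add0n.
by case: (pairmap _ _ _).
Qed.

End DescentWeights.

Section TildeSum.
Context {n : nat} (K : {set 'I_n.-1}) {R : idomainType} (t : R).
Implicit Types (w : 'S_n).

Lemma descent_bits_perm w :
  descent_bits (perm_word w) = [seq i \in Des w | i <- enum 'I_n.-1].
Proof.
rewrite perm_wordE; case: n w => [|m] w; first by rewrite !enum_ord0.
have sz : size [seq i \in Des w | i <- enum 'I_m] = m by rewrite size_map size_enum_ord.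
apply: (@eq_from_nth _ false) => [|i].
  by rewrite sz enum_ordSl /= size_pairmap !size_map -?enumT size_enum_ord.
rewrite enum_ordSl /= size_pairmap !size_map -?enumT size_enum_ord => im.
have -> : [seq w j | j <- [seq lift ord0 j | j <- enum 'I_m]] =
    behead [seq w j | j <- enum 'I_m.+1].
  by rewrite enum_ordSl.
have e : w ord0 :: behead [seq w j | j <- enum 'I_m.+1] = [seq w j | j <- enum 'I_m.+1].
  by rewrite enum_ordSl.
rewrite (nth_pairmap (w ord0)); last by rewrite enum_ordSl /= !size_map -?enumT size_enum_ord.
rewrite e (nth_map (Ordinal im)) ?size_enum_ord // inE nth_behead.
have im' : (i < m.+1)%N by rewrite ltnW.
rewrite !(nth_map ord0) -?enumT ?size_enum_ord //.
by congr (w _ < w _)%N; apply/val_inj; rewrite /= !nth_enum_ord.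
Qed.

Lemma count_descent_bits w : count id (descent_bits (perm_word w)) = des w.
Proof.
rewrite descent_bits_perm count_map -size_filter /des cardE; congr size.
by rewrite [RHS]/enum_mem enumT; apply: eq_filter.
Qed.

Lemma sorted_descent_bits w : sorted nodd_rel (descent_bits (perm_word w)) = ~~ double_descent w.
Proof.
rewrite descent_bits_perm; apply/(sortedP false)/exists_inPn => [srt i iD|ndd i].
  apply/exists_inPn => j jD; apply/negP => /eqP ji.
  have := srt i; rewrite size_map size_enum_ord -ji => /(_ (ltn_ord j)).
  rewrite (nth_map i false) ?size_enum_ord // (nth_map i false) ?size_enum_ord // !nth_ord_enum.
  by rewrite /nodd_rel iD jD.
rewrite size_map size_enum_ord => lt_i.
pose a := Ordinal (ltnW lt_i); pose b := Ordinal lt_i.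
rewrite (nth_map a false) ?size_enum_ord ?(ltnW lt_i) // (nth_map a false) ?size_enum_ord //.
have -> : nth a (enum 'I_n.-1) i = a := nth_ord_enum a a.
have -> : nth a (enum 'I_n.-1) i.+1 = b := nth_ord_enum a b.
rewrite /nodd_rel; apply/negP => /andP[aD bD].
by have /exists_inPn/(_ b bD) := ndd a aD; rewrite /= eqxx.
Qed.

Lemma head_descent_bits w : head false (descent_bits (perm_word w)) = initial_descent w.
Proof.
rewrite descent_bits_perm -nth0; apply/idP/exists_inP => [|[i iD /eqP i0]].
  case: (posnP n.-1) => [n0|n0].
    by rewrite nth_default // size_map size_enum_ord n0.
  rewrite (nth_map (Ordinal n0) false) ?size_enum_ord // => iD.
  by exists (nth (Ordinal n0) (enum 'I_n.-1) 0); rewrite // nth_enum_ord.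
have n0 : (0 < n.-1)%N by rewrite -i0 ltn_ord.
rewrite (nth_map i false) ?size_enum_ord //.
by have -> : nth i (enum 'I_n.-1) 0 = i by apply/val_inj; rewrite /= nth_enum_ord // i0.
Qed.

Lemma tail_weight_perm w : (0 < n)%N -> tail_weight t (perm_word w) =
  if ~~ double_descent w && ~~ initial_descent w then
    t ^+ des w * (1 + t) ^+ (n.-1 - (des w).*2) else 0.
Proof.
move=> n0; have := size_tuple (perm_word w).
have := count_descent_bits w; have := sorted_descent_bits w; have := head_descent_bits w.
case: (tval (perm_word w)) => [|x u <- <- <- szu].
  by move=> _ _ _ /eqP; rewrite /= eq_sym gtn_eqF.
have -> : n.-1 = size u by rewrite -(congr1 predn szu).
by rewrite tail_weightE.
Qed.

Lemma des_tilde_le w : w \in WK_tilde K -> (des w <= (n.-1)./2)%N.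
Proof.
rewrite !inE => /and3P[_ dd di]; have := @count_sorted (descent_bits (perm_word w)).
rewrite sorted_descent_bits head_descent_bits count_descent_bits => /(_ dd)[_ /(_ di)].
by rewrite descent_bits_perm size_map size_enum_ord geq_half_double.
Qed.

Lemma tail_sum_tilde : (0 < n)%N -> tail_sum K t set0 =
  \sum_(w in WK_tilde K) t ^+ des w * (1 + t) ^+ (n.-1 - (des w).*2).
Proof.
move=> n0; rewrite /tail_sum; have -> : ((set0 : {set 'I_n}) == setT) = false.
  by apply/negP => /eqP/setP/(_ (Ordinal n0)); rewrite !inE.
rewrite add0r word_sum_perm; under eq_bigr do rewrite tail_weight_perm //.
by rewrite -big_mkcondr; apply: eq_bigl => w; rewrite [RHS]inE.
Qed.

End TildeSum.

(** * Reversal and the theorem *)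

Section Duality.
Context {n : nat}.
Implicit Types (S T : {set 'I_n}) (D : {set {set 'I_n}}) (J K : {set 'I_n.-1}) (w : 'S_n).

Lemma posl_rev (k : 'I_n.-1) : posl (rev_ord k) = rev_ord (posr k).
Proof. by apply/val_inj => /=; have := ltn_ord k; lia. Qed.

Lemma posr_rev (k : 'I_n.-1) : posr (rev_ord k) = rev_ord (posl k).
Proof. by apply/val_inj => /=; have := ltn_ord k; lia. Qed.

Lemma rev_ord_lt (m : nat) (i j : 'I_m) : (rev_ord i < rev_ord j)%N = (j < i)%N.
Proof. by have := ltn_ord i; have := ltn_ord j; rewrite /=; lia. Qed.

Definition rev_set (m : nat) (A : {set 'I_m}) : {set 'I_m} := [set i | rev_ord i \in A].

(** Reversal alone would turn low sets into sets closed upwards; the complement makes them low for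
    the reversed [K]. *)
Definition dual_set S : {set 'I_n} := ~: rev_set S.

Definition dual_chain D : {set {set 'I_n}} := [set S | dual_set S \in D].

Lemma mem_dual_set i S : (i \in dual_set S) = (rev_ord i \notin S).
Proof. by rewrite !inE. Qed.

Lemma rev_setK m : involutive (@rev_set m).
Proof. by move=> A; apply/setP => i; rewrite !inE rev_ordK. Qed.

Lemma dual_setK : involutive dual_set.
Proof. by move=> S; apply/setP => i; rewrite !mem_dual_set rev_ordK negbK. Qed.

Lemma dual_chainK : involutive dual_chain.
Proof. by move=> D; apply/setP => S; rewrite !inE dual_setK. Qed.

Lemma card_rev_set m (A : {set 'I_m}) : #|rev_set A| = #|A|.
Proof. exact: card_preimset (@rev_ord_inj m). Qed.

Lemma card_dual_chain D : #|dual_chain D| = #|D|.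
Proof. exact: card_preimset (inv_inj dual_setK). Qed.

Lemma dual_setT : dual_set setT = set0.
Proof. by apply/setP => i; rewrite mem_dual_set !inE. Qed.

Lemma dual_set0 : dual_set set0 = setT.
Proof. by rewrite -dual_setT dual_setK. Qed.

Lemma valid_dual K D J : valid K D J -> valid (rev_set K) (dual_chain D) (rev_set J).
Proof.
move=> /validP[v1 v2 v3 v4]; apply/validP; split.
- move=> S; rewrite inE => /v1[S0 ST /lowP lowS]; split.
  + by apply: contraNneq ST => ->; rewrite dual_set0.
  + by apply: contraNneq S0 => ->; rewrite dual_setT.
  + apply/lowP => k; rewrite inE => kK; apply: contraTT.
    by have := lowS _ kK; rewrite !mem_dual_set posr_rev posl_rev !rev_ordK.
- move=> S T; rewrite !inE => SD TD; rewrite orbC.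
  have sub A B : dual_set A \subset dual_set B -> B \subset A.
    move=> /subsetP s; apply/subsetP => i; apply: contraTT => iA.
    by have := s (rev_ord i); rewrite !mem_dual_set rev_ordK; apply.
  by case/orP: (v2 _ _ SD TD) => /sub ->; rewrite ?orbT.
- by move=> k; rewrite !inE => /v3.
- move=> S k; rewrite !inE => SD kJ; have := v4 _ _ SD kJ.
  by rewrite !mem_dual_set posr_rev posl_rev !rev_ordK => /negb_inj.
Qed.

Lemma sum_valid_dual (V : nmodType) K (f : nat -> V) :
  \sum_(DJ | valid K DJ.1 DJ.2) f (#|DJ.1| + #|DJ.2|)%N =
  \sum_(DJ | valid (rev_set K) DJ.1 DJ.2) f (#|DJ.1| + #|DJ.2|)%N.
Proof.
pose h (DJ : {set {set 'I_n}} * {set 'I_n.-1}) := (dual_chain DJ.1, rev_set DJ.2).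
have hK : involutive h by move=> [D J]; rewrite /h /= dual_chainK rev_setK.
rewrite [RHS](reindex_inj (inv_inj hK)); apply: eq_big => [[D J]|[D J] _] /=.
  apply/idP/idP; first exact: valid_dual.
  by move/valid_dual; rewrite !rev_setK dual_chainK.
by rewrite card_dual_chain card_rev_set.
Qed.

Definition rev_perm : 'S_n := perm (@rev_ord_inj n).

(** Conjugation by the longest element of the symmetric group. *)
Definition dual_perm w : 'S_n := (rev_perm * w * rev_perm)%g.

Lemma dual_permE w i : dual_perm w i = rev_ord (w (rev_ord i)).
Proof. by rewrite !permM !permE. Qed.

Lemma dual_permK : involutive dual_perm.
Proof. by move=> w; apply/permP => i; rewrite !dual_permE !rev_ordK. Qed.

Lemma dual_permV w : ((dual_perm w)^-1 = dual_perm w^-1)%g.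
Proof.
apply: (mulgI (dual_perm w)); rewrite mulgV; apply/permP => i.
by rewrite perm1 permM !dual_permE rev_ordK permK rev_ordK.
Qed.

Lemma Des_dual w : Des (dual_perm w) = rev_set (Des w).
Proof.
by apply/setP => k; rewrite !inE !dual_permE rev_ord_lt posl_rev posr_rev.
Qed.

Lemma des_dual w : des (dual_perm w) = des w.
Proof. by rewrite /des Des_dual card_rev_set. Qed.

Lemma double_descent_dual w : double_descent w -> double_descent (dual_perm w).
Proof.
move=> /exists_inP[i iD /exists_inP[j jD /eqP ji]].
apply/exists_inP; exists (rev_ord j); first by rewrite Des_dual inE rev_ordK.
apply/exists_inP; exists (rev_ord i); first by rewrite Des_dual inE rev_ordK.
by have := ltn_ord j; have := ltn_ord i; rewrite /= => ? ?; apply/eqP; lia.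
Qed.

Lemma initial_descent_dual w : initial_descent (dual_perm w) = final_descent w.
Proof.
apply/exists_inP/exists_inP => -[i iD /eqP ei].
  exists (rev_ord i); first by move: iD; rewrite Des_dual inE.
  by have := ltn_ord i; rewrite /= => ?; apply/eqP; lia.
exists (rev_ord i); first by rewrite Des_dual inE rev_ordK.
by have := ltn_ord i; rewrite /= => ?; apply/eqP; lia.
Qed.

Lemma WK_dual K w : w \in WK K -> dual_perm w \in WK (rev_set K).
Proof.
move=> /WK_P wK; apply/WK_P => k; rewrite inE => /wK.
by rewrite dual_permV !dual_permE rev_ord_lt posl_rev posr_rev.
Qed.

Lemma tilde_dual K w : (dual_perm w \in WK_tilde (rev_set K)) = (w \in WK_hat K).
Proof.
rewrite [LHS]inE [RHS]inE initial_descent_dual; congr [&& _, ~~ _ & _].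
  apply/idP/idP; last exact: WK_dual.
  by move=> /WK_dual; rewrite rev_setK dual_permK.
apply/idP/idP; last exact: double_descent_dual.
by move=> /double_descent_dual; rewrite dual_permK.
Qed.

Lemma card_hat_dual K j :
  #|[set w in WK_hat K | des w == j]| = #|[set w in WK_tilde (rev_set K) | des w == j]|.
Proof.
rewrite -[RHS](card_preimset _ (inv_inj dual_permK)); apply: eq_card => w.
by rewrite [LHS]inE [RHS]inE [in RHS]inE tilde_dual des_dual.
Qed.

End Duality.

(** The family is triangular: the term of index j starts with the monomial of degree j, with
    coefficient 1. *)
Lemma gamma_basis_free (N m : nat) (c : nat -> int) :
  \sum_(j < m) c j *: ('X^j * (1 + 'X) ^+ (N - j.*2)) = 0 :> {poly int} ->
  forall j, (j < m)%N -> c j = 0.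
Proof.
move=> sum0 j; have [k] := ubnP j; elim: k j => // k IH j lt_jk lt_jm.
have := congr1 (fun p : {poly int} => p`_j) sum0; rewrite coef0 coef_sum.
rewrite (bigD1 (Ordinal lt_jm)) //= big1 ?addr0; last first.
  move=> i ij; rewrite coefZ coefXnM; case: (ltngtP j i) => [|lt_ij|eqij]; first by rewrite mulr0.
    by rewrite IH ?mul0r //; lia.
  by move: ij; rewrite -(inj_eq val_inj) /= eqij eqxx.
rewrite coefZ coefXnM ltnn subnn -horner_coef0 horner_exp hornerD hornerX hornerC addr0.
by rewrite expr1n mulr1.
Qed.

Lemma sum_tilde_by_des (n : nat) (K : {set 'I_n.-1}) :
  \sum_(w in WK_tilde K) 'X ^+ des w * (1 + 'X) ^+ (n.-1 - (des w).*2) =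
  \sum_(j < (n.-1)./2.+1)
     #|[set w in WK_tilde K | des w == j]|%:R *: ('X^j * (1 + 'X) ^+ (n.-1 - j.*2)) :> {poly int}.
Proof.
(* By [des_tilde_le] the number of descents is within range, so [inord] does not change it. *)
rewrite (partition_big (fun w => inord (des w) : 'I_(n.-1)./2.+1) xpredT) //=.
apply: eq_bigr => j _; rewrite scaler_nat -sumr_const; apply: eq_big => w.
  rewrite [RHS]inE; case: (boolP (w \in WK_tilde K)) => //= /des_tilde_le le.
  by rewrite -(inj_eq val_inj) /= inordK.
by move=> /andP[/des_tilde_le le /eqP <-]; rewrite inordK.
Qed.

Lemma sum_valid_tilde (n : nat) (K : {set 'I_n.-1}) : (0 < n)%N ->
  \sum_(DJ | valid K DJ.1 DJ.2) ('X - 1) ^+ (n.-1 - (#|DJ.1| + #|DJ.2|)) =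
  \sum_(j < (n.-1)./2.+1)
     #|[set w in WK_tilde K | des w == j]|%:R *: ('X^j * (1 + 'X) ^+ (n.-1 - j.*2)) :> {poly int}.
Proof.
move=> n0; rewrite sum_valid // -sum_tilde_by_des -tail_sum_tilde //.
rewrite tail_sum_chain_sum //; last by apply/lowP => k _; rewrite inE.
(* The condition t != 1 of [tail_sum_chain_sum], for t the indeterminate. *)
by apply/eqP => /(congr1 (fun p : {poly int} => p`_1)); rewrite coefX coef1.
Qed.

Theorem theorem3p2 (R : realType) (n : nat) (hn : (0 < n)%N)
    (p : 'rV[R]_n) (hp : injective (fun i : 'I_n => p 0 i))
    (K : {set 'I_n.-1}) :
  hpoly n.-1 (part_permutohedron p K) =
    \sum_(j < (n.-1)./2.+1)
       #|[set w in WK_tilde K | des w == j]|%:R *: ('X^j * (1 + 'X) ^+ (n.-1 - j.*2))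
  /\ (forall j : nat, (j <= (n.-1)./2)%N ->
        #|[set w in WK_tilde K | des w == j]| = #|[set w in WK_hat K | des w == j]|).
Proof.
split.
  have [q q_mono ->] := sorted_part_permutohedron K hp.
  by rewrite hpoly_valid // sum_valid_tilde.
move=> j le_j; rewrite card_hat_dual.
pose a (L : {set 'I_n.-1}) i : int := #|[set w in WK_tilde L | des w == i]|%:R.
(* The sums for [K] and for its reversal agree; expanding both by [sum_valid_tilde] reduces the
   claim to the independence of the family. *)
have := sum_valid_dual K (fun m => ('X - 1) ^+ (n.-1 - m) : {poly int}).
rewrite !sum_valid_tilde // => /eqP; rewrite -subr_eq0 -sumrB => /eqP eq0.
apply/eqP; rewrite -(eqr_nat int) -subr_eq0; apply/eqP.
apply: (@gamma_basis_free n.-1 (n.-1)./2.+1 (fun i => a K i - a (rev_set K) i)) => //.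
by rewrite -[RHS]eq0; apply: eq_bigr => i _; rewrite scalerBl.
Qed.
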